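(* Let $k$ be a perfect field and let $S$ be a birational (Nisnevich) sheaf on $Sm_k^{ft}$. If $X\in Sm_k^{ft}$ is retract $(-i)$-rational, then $S(X)$ is a direct summand of $S(Z^i)$ for some $Z^i\in Sm_k^{ft}$ of dimension $i$.
   Context: $Sm_k^{ft}$ is the category of smooth $k$-schemes of finite type; a $k$-variety is an integral separated $k$-scheme of finite type. A presheaf $S:(Sm_k^{ft})^{op}\to\mathcal{C}$ ($\mathcal{C}$ = sets, groups, abelian groups) is birational if (B0) for every $X\in Sm_k^{ft}$, the map $S(X)\to\prod_{\alpha\in X^{(0)}}S(X_\alpha)$ is a bijection, where $X_\alpha$ are the irreducible components of $X$; (B1) for every $X\in Sm_k^{ft}$ and every everywhere dense open subscheme $U\subset X$, the restriction $S(X)\to S(U)$ is a bijection. A birational presheaf is automatically a Nisnevich sheaf. An $n$-dimensional $k$-variety $X$ is retract $(-i)$-rational ($0\le i\le n$) if there exist $N\ge n$, an $i$-dimensional smooth $k$-variety $Z^i$ (with $Z^0=\mathrm{Spec}\,k$ for $i=0$) and rational maps $f:X\dashrightarrow\mathbb{A}^{N-i}\times Z^i$ and $g:\mathbb{A}^{N-i}\times Z^i\dashrightarrow X$ such that $g\circ f:X\dashrightarrow X$ is defined and equal to the identity on a dense open subset of $X$. ''Direct summand'' means retract in $\mathcal{C}$: there are morphisms $S(X)\to S(Z^i)\to S(X)$ in $\mathcal{C}$ with composite the identity. *)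

(* Defs.v *)
From HB Require Import structures.
From mathcomp Require Import all_boot all_order all_algebra all_field.
From mathcomp Require Import boolp classical_sets.

Set Implicit Arguments.
Unset Strict Implicit.
Unset Printing Implicit Defensive.

Import GRing.Theory.
Local Open Scope ring_scope.
Local Open Scope classical_set_scope.

(* Schemes over a field k are represented by their functors of points, in the
   sense of Demazure-Gabriel, Groupes algebriques, I.1: a k-scheme is a
   Zariski-local functor from commutative k-algebras to sets that is covered by
   open affine subfunctors, and morphisms of k-schemes are natural
   transformations. *)

Definition perfect_field (k : fieldType) : Prop :=
  forall p : {poly k}, irreducible_poly p -> separable_poly p.

(* The zero ring is allowed, hence comPzRingType rather than comAlgType, whose
   carriers are nontrivial. *)
Record kalg (k : fieldType) := KAlg {
  kring :> comPzRingType;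
  kstr : {rmorphism k -> kring} }.

Record khom (k : fieldType) (A B : kalg k) := KHom {
  khom_fun :> {rmorphism A -> B};
  khom_str : forall c, khom_fun (kstr A c) = kstr B c }.

Section Schemes.
Context {k : fieldType}.
Implicit Types A B K : kalg k.

Lemma khom_ext A B (f g : khom A B) : f =1 g -> f = g.
Proof.
case: f => f pf; case: g => g pg /= fg.
have E : f = g :> {rmorphism A -> B}.
  case: f g fg {pf pg} => f [[f1] [f2]] [g [[g1] [g2]]] /= fg.
  have {}fg : f = g by apply/funext.
  by subst g; do 3 f_equal; apply: Prop_irrelevance.
by subst g; f_equal; apply: Prop_irrelevance.
Qed.

Definition khom_id A : khom A A := @KHom k A A idfun (fun=> erefl).

Fact khom_comp_str A B K (g : khom B K) (f : khom A B) (c : k) :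
  (g \o f : {rmorphism A -> K}) (kstr A c) = kstr K c.
Proof. by rewrite /= !khom_str. Qed.

Definition khom_comp A B K (g : khom B K) (f : khom A B) : khom A K :=
  KHom (khom_comp_str g f).

Definition kbase : kalg k := @KAlg k k idfun.

Definition is_field (K : kalg k) : Prop :=
  1 <> 0 :> K /\ forall x : K, x <> 0 -> exists y, x * y = 1.

Definition is_domain (A : kalg k) : Prop :=
  1 <> 0 :> A /\ forall x y : A, x * y = 0 -> x = 0 \/ y = 0.

Definition finitely_generated (A : kalg k) : Prop :=
  exists s : seq A, forall P : A -> Prop,
    (forall c, P (kstr A c)) ->
    (forall x y, P x -> P y -> P (x + y)) ->
    (forall x y, P x -> P y -> P (x * y)) ->
    (forall x, x \in s -> P x) ->
    forall x, P x.

(* The ideal generated by P is the whole ring. *)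
Definition generates_unit_ideal (A : kalg k) (P : set A) : Prop :=
  exists n (b c : 'I_n -> A),
    (forall i, P (c i)) /\ \sum_(i < n) b i * c i = 1.

(* l exhibits B as the localization A[1/f]. *)
Definition is_localization A B (f : A) (l : khom A B) : Prop :=
  [/\ exists u, l f * u = 1,
      forall b, exists n a, b * l f ^+ n = l a
    & forall a, l a = 0 -> exists n, f ^+ n * a = 0].

Record kfunctor := KFunctor {
  ev :> kalg k -> Type;
  fmap : forall A B, khom A B -> ev A -> ev B;
  fmap_id : forall A x, fmap (khom_id A) x = x;
  fmap_comp : forall A B K (g : khom B K) (f : khom A B) x,
    fmap (khom_comp g f) x = fmap g (fmap f x) }.
Arguments fmap X {A B} : rename.

Record mor (X Y : kfunctor) := Mor {
  mor_fun :> forall A, X A -> Y A;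
  mor_nat : forall A B (f : khom A B) x,
    mor_fun (fmap X f x) = fmap Y f (mor_fun x) }.
Arguments mor_fun {X Y} _ {A}.

Definition mor_id (X : kfunctor) : mor X X :=
  @Mor X X (fun A x => x) (fun _ _ _ _ => erefl).

Fact mor_comp_nat X Y Z (g : mor Y Z) (f : mor X Y) A B (h : khom A B) x :
  g B (f B (fmap X h x)) = fmap Z h (g A (f A x)).
Proof. by rewrite !mor_nat. Qed.

Definition mor_comp X Y Z (g : mor Y Z) (f : mor X Y) : mor X Z :=
  Mor (mor_comp_nat g f).

Definition isomorphic (X Y : kfunctor) : Prop :=
  exists (f : mor X Y) (g : mor Y X),
    (forall A (x : X A), g A (f A x) = x) /\
    (forall A (y : Y A), f A (g A y) = y).

Fact Spec_id A B (x : khom A B) : khom_comp (khom_id B) x = x.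
Proof. exact: khom_ext. Qed.

Fact Spec_comp A B K L (g : khom K L) (f : khom B K) (x : khom A B) :
  khom_comp (khom_comp g f) x = khom_comp g (khom_comp f x).
Proof. exact: khom_ext. Qed.

Definition Spec (A : kalg k) : kfunctor :=
  @KFunctor (khom A) (fun _ _ f x => khom_comp f x) (@Spec_id A) (@Spec_comp A).

Fact affine_space_id n A (x : 'rV[A]_n) : map_mx (khom_id A) x = x.
Proof. by apply/matrixP => i j; rewrite mxE. Qed.

Fact affine_space_comp n A B K (g : khom B K) (f : khom A B) (x : 'rV[A]_n) :
  map_mx (khom_comp g f) x = map_mx g (map_mx f x).
Proof. by apply/matrixP => i j; rewrite !mxE. Qed.

Definition affine_space (n : nat) : kfunctor :=
  @KFunctor (fun A => 'rV[A]_n) (fun _ _ f x => map_mx f x)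
    (@affine_space_id n) (@affine_space_comp n).

Fact prod_id (X Y : kfunctor) A (p : X A * Y A) :
  (fmap X (khom_id A) p.1, fmap Y (khom_id A) p.2) = p.
Proof. by case: p => x y; rewrite !fmap_id. Qed.

Fact prod_comp (X Y : kfunctor) A B K (g : khom B K) (f : khom A B)
    (p : X A * Y A) :
  (fmap X (khom_comp g f) p.1, fmap Y (khom_comp g f) p.2) =
  (fmap X g (fmap X f p.1), fmap Y g (fmap Y f p.2)).
Proof. by rewrite !fmap_comp. Qed.

Definition kprod (X Y : kfunctor) : kfunctor :=
  @KFunctor (fun A => (X A * Y A)%type)
    (fun _ _ f p => (fmap X f p.1, fmap Y f p.2))
    (@prod_id X Y) (@prod_comp X Y).

Record subfunctor (X : kfunctor) := SubFunctor {
  mem_sub :> forall A, X A -> Prop;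
  sub_fmap : forall A B (f : khom A B) x, mem_sub x -> mem_sub (fmap X f x) }.
Arguments mem_sub {X} _ {A} _.

Section SubToFunctor.
Variables (X : kfunctor) (U : subfunctor X).

Definition sub_map A B (f : khom A B) (x : {x : X A | U A x}) :
    {x : X B | U B x} :=
  exist _ (fmap X f (sval x)) (sub_fmap f (svalP x)).

Fact sub_map_id A x : sub_map (khom_id A) x = x.
Proof. by case: x => x Ux; apply: eq_exist; rewrite /= fmap_id. Qed.

Fact sub_map_comp A B K (g : khom B K) (f : khom A B) x :
  sub_map (khom_comp g f) x = sub_map g (sub_map f x).
Proof. by case: x => x Ux; apply: eq_exist; rewrite /= fmap_comp. Qed.

Definition sub_to_functor : kfunctor := KFunctor sub_map_id sub_map_comp.
End SubToFunctor.
Coercion sub_to_functor : subfunctor >-> kfunctor.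

Fact mor_image_fmap X Y (j : mor Y X) A B (f : khom A B) (x : X A) :
  (exists y, j A y = x) -> exists y, j B y = fmap X f x.
Proof. by case=> y <-; exists (fmap Y f y); rewrite mor_nat. Qed.

Definition mor_image X Y (j : mor Y X) : subfunctor X :=
  @SubFunctor X (fun A x => exists y, j A y = x) (@mor_image_fmap X Y j).

(* The inverse image of U along any x : Spec A -> X is the open subfunctor
   D(I) of Spec A, whose B-points are the f : A -> B with f(I)B = B. *)
Definition open_sub X (U : subfunctor X) : Prop :=
  forall A (x : X A), exists I : set A, forall B (f : khom A B),
    U B (fmap X f x) <-> generates_unit_ideal (f @` I).

(* The inverse image of Z along any x : Spec A -> X is the closed subfunctor
   V(I) of Spec A, whose B-points are the f : A -> B with f(I) = 0. *)
Definition closed_sub X (Z : subfunctor X) : Prop :=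
  forall A (x : X A), exists I : set A, forall B (f : khom A B),
    Z B (fmap X f x) <-> (forall a, I a -> f a = 0).

Definition monomorphism X Y (j : mor Y X) : Prop :=
  forall A, injective (@mor_fun Y X j A).

Definition open_immersion X Y (j : mor Y X) : Prop :=
  monomorphism j /\ open_sub (mor_image j).

Definition closed_immersion X Y (j : mor Y X) : Prop :=
  monomorphism j /\ closed_sub (mor_image j).

(* Points of |X|, before identifying (K, x) and (L, y) when they agree over a
   common field extension of K and L. The points that get identified lie in the
   same open sets, so the closed sets below are those of |X|. *)
Record pt (X : kfunctor) := Pt {
  pt_alg : kalg k;
  pt_field : is_field pt_alg;
  pt_val : X pt_alg }.

(* Sets of points are bare predicates: pt X lives in too large a universe for
   classical_sets.set. *)
Definition pts X (U : subfunctor X) (p : pt X) : Prop :=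
  U (pt_alg p) (pt_val p).

Definition pt_subset X (C D : pt X -> Prop) : Prop := forall p, C p -> D p.

Definition closed_set X (C : pt X -> Prop) : Prop :=
  exists2 U : subfunctor X, open_sub U & forall p, C p <-> ~ pts U p.

Definition irreducible_closed X (C : pt X -> Prop) : Prop :=
  [/\ closed_set C, exists p, C p
    & forall D E, closed_set D -> closed_set E ->
        (forall p, C p -> D p \/ E p) -> pt_subset C D \/ pt_subset C E].

Definition irreducible_component X (C : pt X -> Prop) : Prop :=
  irreducible_closed C /\
  forall D, irreducible_closed D -> pt_subset C D -> pt_subset D C.

Definition has_chain X (n : nat) : Prop :=
  exists C : nat -> pt X -> Prop,
    (forall m, (m <= n)%N -> irreducible_closed (C m)) /\
    (forall m, (m < n)%N ->
       pt_subset (C m) (C m.+1) /\ ~ pt_subset (C m.+1) (C m)).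

Definition krull_dim X (n : nat) : Prop := has_chain X n /\ ~ has_chain X n.+1.

Definition dense_sub X (U : subfunctor X) : Prop :=
  forall V : subfunctor X, open_sub V -> (exists p, pts V p) ->
    exists p, pts U p /\ pts V p.

(* Compatibility is required over every algebra under B i and B j, rather than
   over the localization at f i * f j, which is the initial one. *)
Definition zariski_sheaf (X : kfunctor) : Prop :=
  forall A n (f : 'I_n -> A) (B : 'I_n -> kalg k)
    (l : forall i, khom A (B i)) (x : forall i, X (B i)),
    generates_unit_ideal (range f) ->
    (forall i, is_localization (f i) (l i)) ->
    (forall i j (K : kalg k) (u : khom (B i) K) (v : khom (B j) K),
        (forall a, u (l i a) = v (l j a)) ->
        fmap X u (x i) = fmap X v (x j)) ->
    exists! y : X A, forall i, fmap X (l i) y = x i.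

Definition affine_open_cover X (I : Type) (A : I -> kalg k)
    (j : forall i, mor (Spec (A i)) X) : Prop :=
  (forall i, open_immersion (j i)) /\
  forall K (x : X K), is_field K -> exists i, mor_image (j i) K x.

Definition is_scheme (X : kfunctor) : Prop :=
  zariski_sheaf X /\
  exists (I : Type) (A : I -> kalg k) (j : forall i, mor (Spec (A i)) X),
    affine_open_cover j.

Definition finite_type (X : kfunctor) : Prop :=
  exists n (A : 'I_n -> kalg k) (j : forall i, mor (Spec (A i)) X),
    affine_open_cover j /\ forall i, finitely_generated (A i).

Definition formally_smooth (X : kfunctor) : Prop :=
  forall A B (q : khom A B),
    (forall b, exists a, q a = b) ->
    (forall a a', q a = 0 -> q a' = 0 -> a * a' = 0) ->
    forall y : X B, exists x : X A, fmap X q x = y.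

Fact diagonal_fmap (X : kfunctor) A B (f : khom A B) (p : kprod X X A) :
  p.1 = p.2 -> (fmap (kprod X X) f p).1 = (fmap (kprod X X) f p).2.
Proof. by move=> /= ->. Qed.

Definition diagonal (X : kfunctor) : subfunctor (kprod X X) :=
  @SubFunctor (kprod X X) (fun A p => p.1 = p.2) (@diagonal_fmap X).

Definition separated (X : kfunctor) : Prop := closed_sub (diagonal X).

Definition integral (X : kfunctor) : Prop :=
  inhabited (pt X) /\
  forall A (j : mor (Spec A) X),
    open_immersion j -> 1 <> 0 :> A -> is_domain A.

Definition variety (X : kfunctor) : Prop :=
  [/\ is_scheme X, finite_type X, separated X & integral X].

(* Smooth means formally smooth and locally of finite presentation (EGA IV
   17.3.1). Finite type over a field implies finite presentation. *)
Record Sm := MkSm {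
  Sm_fun :> kfunctor;
  Sm_scheme : is_scheme Sm_fun;
  Sm_finite_type : finite_type Sm_fun;
  Sm_formally_smooth : formally_smooth Sm_fun }.

(* A representative of a rational map X --> Y. *)
Record ratmap (X Y : kfunctor) := RatMap {
  rat_dom : subfunctor X;
  rat_open : open_sub rat_dom;
  rat_dense : dense_sub rat_dom;
  rat_mor :> mor rat_dom Y }.

(* g o f is defined and equal to the identity on a dense open subset of X. *)
Definition rat_retraction X Y (f : ratmap X Y) (g : ratmap Y X) : Prop :=
  exists W : subfunctor X,
    [/\ open_sub W, dense_sub W
      & forall A (x : X A), W A x ->
          exists (u : rat_dom f A x) (v : rat_dom g A (f A (exist _ x u))),
            g A (exist _ (f A (exist _ x u)) v) = x].

(* retract_rational i is retract (-i)-rationality in the usual terminology. *)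
Definition retract_rational (i : nat) (X : kfunctor) : Prop :=
  variety X /\
  exists n, [/\ krull_dim X n, (i <= n)%N
    & exists (N : nat) (Z : Sm),
        [/\ (n <= N)%N, variety Z, krull_dim Z i,
            i = 0%N -> isomorphic Z (Spec kbase)
          & exists (f : ratmap X (kprod (affine_space (N - i)) Z))
                   (g : ratmap (kprod (affine_space (N - i)) Z) X),
              rat_retraction f g]].

End Schemes.
Arguments Sm : clear implicits.
Arguments dense_sub {k X} U.

Inductive coefficients := Sets | Groups | AbelianGroups.

Definition obj (C : coefficients) : Type :=
  match C with
  | Sets => Type
  | Groups => groupType
  | AbelianGroups => zmodType
  end.

Definition elt (C : coefficients) : obj C -> Type :=
  match C with
  | Sets => fun S : Type => S
  | Groups => fun G : groupType => (G : Type)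
  | AbelianGroups => fun M : zmodType => (M : Type)
  end.

Definition hom (C : coefficients) : obj C -> obj C -> Type :=
  match C with
  | Sets => fun S T : Type => S -> T
  | Groups => fun G H : groupType => {multiplicative G -> H}
  | AbelianGroups => fun M N : zmodType => {additive M -> N}
  end.

Definition app (C : coefficients) : forall a b : obj C, hom a b -> elt a -> elt b :=
  match C with
  | Sets => fun (S T : Type) (f : S -> T) => f
  | Groups => fun (G H : groupType) (f : {multiplicative G -> H}) =>
      (f : G -> H)
  | AbelianGroups => fun (M N : zmodType) (f : {additive M -> N}) => (f : M -> N)
  end.

Definition direct_summand (C : coefficients) (a b : obj C) : Prop :=
  exists (s : hom a b) (r : hom b a), forall x, app r (app s x) = x.

Record presheaf (k : fieldType) (C : coefficients) := Presheaf {
  sections :> Sm k -> obj C;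
  pullback : forall X Y : Sm k, mor X Y -> hom (sections Y) (sections X);
  pullback_id : forall (X : Sm k) s, app (pullback (mor_id X)) s = s;
  pullback_comp : forall (X Y Z : Sm k) (g : mor Y Z) (f : mor X Y) s,
    app (pullback (mor_comp g f)) s = app (pullback f) (app (pullback g) s) }.

(* Irreducible components carry their reduced structure, so they are integral
   closed subschemes. *)
Definition birational_B0 (k : fieldType) (C : coefficients) (S : presheaf k C) :
    Prop :=
  forall (X : Sm k) (Xc : {c : pt X -> Prop | irreducible_component c} -> Sm k)
    (j : forall a, mor (Xc a) X),
    (forall a, [/\ closed_immersion (j a), integral (Xc a)
                 & forall p, pts (mor_image (j a)) p <-> sval a p]) ->
    forall s : forall a, elt (S (Xc a)),
      exists! x : elt (S X), forall a, app (pullback S (j a)) x = s a.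

Definition birational_B1 (k : fieldType) (C : coefficients) (S : presheaf k C) :
    Prop :=
  forall (X U : Sm k) (j : mor U X),
    open_immersion j -> dense_sub (mor_image j) ->
    bijective (app (pullback S j)).

Definition birational (k : fieldType) (C : coefficients) (S : presheaf k C) :
    Prop :=
  birational_B0 S /\ birational_B1 S.

(* Main.v *)
(* By (B1), S(Y) = S(dom g) and S(X) = S(W) for W the dense open set on which
   g o f = id, so S(X) -> S(dom g) -> S(W), along g and then f, makes S(X) a
   retract of S(Y), Y = A^m x Z. It remains to see that S(Y) = S(Z). The map
   b : (x, v, z) |-> (x, x v, z) on A^1 x A^m x Z is an isomorphism over
   x <> 0, so b^* is bijective. Given s in S(Y), write its pullback to A^1 x Y
   as b^* s' and restrict to x = 0, where b factors through (v, z) |-> z: hence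
   s comes from S(Z). *)

Require Import Defs.
From HB Require Import structures.
From mathcomp Require Import all_boot all_order all_algebra all_field.
From mathcomp Require Import boolp classical_sets.
From mathcomp Require Import ring.

Set Implicit Arguments.
Unset Strict Implicit.
Unset Printing Implicit Defensive.

Import GRing.Theory.
Local Open Scope ring_scope.
Local Open Scope classical_set_scope.

(** * Ideals and Noetherian rings *)

(** (B1) speaks only of objects of [Sm], so dom g, W, the locus x <> 0 and A^m x Z must first be
    shown to be smooth schemes of finite type. For an open subfunctor, the sheaf condition and
    formal smoothness follow from local arguments on test algebras. Finite type is the obstacle: an
    open subset of an affine chart must be a finite union of basic open sets, whence the Noetherian
    rings and Hilbert's theorem. The map b collapses the fibre x = 0, so it is not an immersion and
    (B1) says nothing about it directly. With j the inclusion of the locus x <> 0, however, both j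
    and b o j are dense open immersions, and b^* is bijective as the quotient of two bijections.
    This collapse is also what makes the restriction to x = 0 informative. The points of W lie in
    dom f and f sends them into dom g, so f becomes a true morphism W -> dom g and no composition of
    rational maps has to be defined. *)

Inductive idl (R : pzSemiRingType) (P : R -> Prop) : R -> Prop :=
| idl_mem x : P x -> idl P x
| idl0 : idl P 0
| idlD x y : idl P x -> idl P y -> idl P (x + y)
| idlM a x : idl P x -> idl P (a * x).

Lemma idl_sub (R : pzSemiRingType) (P Q : R -> Prop) x :
  (forall y, P y -> idl Q y) -> idl P x -> idl Q x.
Proof.
by move=> PQ; elim=> *; [exact: PQ | exact: idl0 | exact: idlD | exact: idlM].
Qed.

Lemma idl_image (R S : pzSemiRingType) (f : {rmorphism R -> S}) (P : R -> Prop) x :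
  idl P x -> idl (f @` P) (f x).
Proof.
elim=> [y Py||y z _ fy _ fz|a y _ fy].
- by apply: idl_mem; exists y.
- by rewrite rmorph0; exact: idl0.
- by rewrite rmorphD; exact: idlD.
- by rewrite rmorphM; exact: idlM.
Qed.

Lemma idl_sum (R : pzSemiRingType) (P : R -> Prop) I (r : seq I) (F : I -> R) :
  (forall i, idl P (F i)) -> idl P (\sum_(i <- r) F i).
Proof.
by move=> PF; elim/big_ind: _ => // *; [exact: idl0 | exact: idlD].
Qed.

Lemma idl_exp_le (R : pzSemiRingType) (P : R -> Prop) x m n :
  (m <= n)%N -> idl P (x ^+ m) -> idl P (x ^+ n).
Proof. by move=> /subnK <- Px; rewrite exprD; exact: idlM. Qed.

(** The elements with a power in the ideal of J form an ideal, by the binomial formula. Local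
    statements on a cover by sets D(c) are glued below in this form. *)
Lemma idl_radical (R : comPzSemiRingType) (P J : R -> Prop) :
  (forall c, P c -> exists n, idl J (c ^+ n)) -> idl P 1 -> idl J 1.
Proof.
move=> PJ P1; suff [n] : exists n, idl J (1 ^+ n) by rewrite expr1n.
elim: P1 => [x /PJ//||x y _ [n Jx] _ [m Jy]|a x _ [n Jx]].
- by exists 1%N; rewrite expr1; exact: idl0.
- exists (n + m)%N; rewrite exprDn; apply: idl_sum => i; rewrite -mulr_natl.
  apply: idlM; have [im|mi] := leqP m i.
    by apply: idlM; exact: idl_exp_le Jy.
  rewrite mulrC; apply: idlM; apply: idl_exp_le Jx.
  by rewrite -addnBA ?leq_addr// ltnW.
- by exists n; rewrite exprMn; exact: idlM.
Qed.

Lemma generates_unit_idealP (k : fieldType) (A : kalg k) (P : set A) :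
  generates_unit_ideal P <-> idl P 1.
Proof.
split=> [[n [b [c [Pc <-]]]]|P1].
  by apply: idl_sum => i; apply: idlM; exact: idl_mem.
have [s Ps s1] : exists2 s : seq (A * A),
    forall p, p \in s -> P p.2 & \sum_(p <- s) p.1 * p.2 = 1.
  elim: P1 => [x Px||x y _ [s Ps <-] _ [t Pt <-]|a x _ [s Ps <-]].
  - by exists [:: (1, x)] => [p|]; rewrite ?inE ?big_seq1 ?mul1r// => /eqP ->.
  - by exists [::]; rewrite ?big_nil.
  - by exists (s ++ t) => [p|]; rewrite ?mem_cat ?big_cat// => /orP[/Ps|/Pt].
  - exists [seq (a * p.1, p.2) | p <- s] => [p /mapP[q /Ps ? ->]//|].
    by rewrite big_map mulr_sumr; apply: eq_bigr => p _; rewrite mulrA.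
exists (size s), (fun i => (nth (0, 0) s i).1), (fun i => (nth (0, 0) s i).2).
by split=> [i|]; [apply: Ps; exact: mem_nth | rewrite -s1 (big_nth (0, 0)) big_mkord].
Qed.

Definition noetherian (R : pzSemiRingType) : Prop :=
  forall P : R -> Prop, exists2 s : seq R,
    forall x, x \in s -> idl P x & forall x, P x -> idl (fun y => y \in s) x.

(** The ideal of all a_i has finitely many generators, and each is a combination of finitely many
    a_i; any n above all these indices works. *)
Lemma noetherian_nat_seq (R : comPzRingType) (a : nat -> R) :
  noetherian R -> exists n, idl (fun x => exists2 i, (i < n)%N & x = a i) (a n).
Proof.
move=> /(_ (range a))[s s_a a_s].
have idl_mono m n x (mn : (m <= n)%N) :
    idl (fun x => exists2 i, (i < m)%N & x = a i) x ->
    idl (fun x => exists2 i, (i < n)%N & x = a i) x.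
  apply: idl_sub => _ [i im ->]; apply: idl_mem.
  by exists i => //; exact: leq_trans mn.
have [n sn] : exists n, forall x, x \in s ->
    idl (fun x => exists2 i, (i < n)%N & x = a i) x.
  elim: s s_a {a_s} => [|x s IH] xs_a; first by exists 0%N.
  have [n sn] : exists n, forall x, x \in s ->
      idl (fun x => exists2 i, (i < n)%N & x = a i) x.
    by apply: IH => y ys; apply: xs_a; rewrite inE ys orbT.
  have [m xm] : exists m, idl (fun x => exists2 i, (i < m)%N & x = a i) x.
    elim: (xs_a x (mem_head _ _)) =>
      [_ [i _ <-]||y z _ [p yp] _ [q zq]|b y _ [p yp]].
    - by exists i.+1; apply: idl_mem; exists i.
    - by exists 0%N; exact: idl0.
    - exists (p + q)%N; apply: idlD.
        exact: idl_mono _ _ _ (leq_addr _ _) yp.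
      exact: idl_mono _ _ _ (leq_addl _ _) zq.
    - by exists p; exact: idlM.
  exists (n + m)%N => y; rewrite inE => /predU1P[->|/sn ys].
    exact: idl_mono _ _ _ (leq_addl _ _) xm.
  exact: idl_mono _ _ _ (leq_addr _ _) ys.
by exists n; apply: idl_sub (a_s _ _); [exact: sn | exists n].
Qed.

Lemma noetherian_field (k : fieldType) : noetherian k.
Proof.
move=> P; have [[x [Px x0]]|/forallNP P0] := pselect (exists x, P x /\ x != 0).
  exists [:: x] => [y|y _]; first by rewrite inE => /eqP ->; exact: idl_mem.
  by rewrite -[y](divfK x0); apply: idlM; apply: idl_mem; rewrite inE.
exists [::] => // x Px; have [->|x0] := eqVneq x 0; first exact: idl0.
by have := P0 x; case.
Qed.

Lemma noetherian_surj (R S : pzSemiRingType) (f : {rmorphism R -> S}) :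
  (forall y, exists x, f x = y) -> noetherian R -> noetherian S.
Proof.
move=> fS nR P; have [s sP Ps] := nR (fun x => P (f x)).
exists [seq f x | x <- s] => [_ /mapP[x /sP xP ->]|y].
  by apply: idl_sub (idl_image f xP) => _ [z Pz <-]; exact: idl_mem.
have [x <-] := fS y => /Ps xs; apply: idl_sub (idl_image f xs) => _ [z zs <-].
by apply: idl_mem; exact: map_f.
Qed.

(* Hilbert: a sequence of elements of minimal degree, each outside the ideal
   of the previous ones, has leading coefficients contradicting
   noetherian_nat_seq. *)
Lemma noetherian_poly (R : comNzRingType) : noetherian R -> noetherian {poly R}.
Proof.
move=> nR P; apply: contrapT => noP.
(* The condition on s stands inside the existential so that [choice] gives a total function; when it
   fails, the value 0 is a mere default. *)
have next (s : seq {poly R}) : exists x, (forall y, y \in s -> idl P y) ->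
    [/\ idl P x, ~ idl (fun y => y \in s) x &
      forall y, idl P y -> ~ idl (fun z => z \in s) y -> (size x <= size y)%N].
  have [sP|] := pselect (forall y, y \in s -> idl P y); last by exists 0.
  pose Q n := `[< exists x : {poly R},
    [/\ idl P x, ~ idl (fun y => y \in s) x & size x = n] >].
  have exQ : exists n, Q n.
    apply: contrapT => /forallNP noQ; apply: noP; exists s => // x Px.
    apply: contrapT => xs; have := noQ (size x); apply; apply/asboolP.
    by exists x; split=> //; exact: idl_mem.
  have [n /asboolP[x [Px xs <-]] minx] := ex_minnP exQ.
  exists x => _; split=> // y Py ys; apply: minx; apply/asboolP.
  by exists y.
have {next}[next nextP] := choice next.
pose fix st n := if n is m.+1 then next (st m) :: st m else [::].
pose f n := next (st n).
have stE n x : x \in st n <-> exists2 i, (i < n)%N & x = f i.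
  elim: n => [|n IH] /=; first by split=> // -[].
  rewrite inE; split=> [/predU1P[->|/IH[i ltin ->]]|[i]].
  - by exists n.
  - by exists i => //; exact: ltnW.
  - rewrite ltnS leq_eqVlt => /predU1P[->|ltin] xE; first by rewrite xE eqxx.
    by apply/orP; right; apply/IH; exists i.
have stP n y : y \in st n -> idl P y.
  elim: n y => [//|n IH] y /=; rewrite inE => /predU1P[->|yn]; last exact: IH.
  by have [] := nextP _ IH.
have fP n : idl P (f n) by have [] := nextP _ (@stP n).
have f_st n : ~ idl (fun y => y \in st n) (f n).
  by have [] := nextP _ (@stP n).
have f_min n y : idl P y -> ~ idl (fun z => z \in st n) y -> (size (f n) <= size y)%N.
  by have [_ _] := nextP _ (@stP n); apply.
have le_size i n : (i < n)%N -> (size (f i) <= size (f n))%N.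
  move=> ltin; apply: f_min => // H; apply: (f_st n).
  apply: idl_sub H => y /stE[j ltji ->].
  by apply: idl_mem; apply/stE; exists j => //; exact: ltn_trans ltin.
have [n an] := noetherian_nat_seq (fun n => lead_coef (f n)) nR.
have fn0 : (0 < size (f n))%N.
  by rewrite size_poly_gt0; apply/eqP => f0; apply: (f_st n); rewrite f0; exact: idl0.
(* The relation between leading coefficients lifts to polynomials: each earlier f i is shifted by a
   power of X up to the degree of f n, which is possible because sizes do not decrease. Then f n - q
   has smaller size, against minimality. *)
have [q [qst szq qn]] : exists q, [/\ idl (fun y => y \in st n) q,
    (size q <= size (f n))%N & q`_(size (f n)).-1 = lead_coef (f n)].
  elim: an => [_ [i ltin ->]||x y _ [p [ps sp px]] _ [q [qs sq qx]]|c x _ [p [ps sp px]]].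
  - exists ('X^(size (f n) - size (f i)) * f i); split.
    + by apply: idlM; apply: idl_mem; apply/stE; exists i.
    + have [->|fi0] := eqVneq (f i) 0; first by rewrite mulr0 size_poly0.
      by rewrite mulrC size_mulXn // subnK // le_size.
    + rewrite coefXnM lead_coefE; have := le_size _ _ ltin => le_in.
      have fi0 : (0 < size (f i))%N.
        rewrite size_poly_gt0; apply/eqP => f0; apply: (f_st i); rewrite f0.
        exact: idl0.
      rewrite ltnNge; have -> : (size (f n) - size (f i) <= (size (f n)).-1)%N.
        rewrite leq_subLR; case: (size (f i)) fi0 => // m _.
        by case: (size (f n)) fn0 => // p _; rewrite addSn ltnS leq_addl.
      congr (_ `_ _) => /=; case: (size (f i)) fi0 le_in => // m _.
      by case: (size (f n)) fn0 => // p _; rewrite ltnS subSS /= => /subKn.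
  - by exists 0; split; [exact: idl0 | rewrite size_poly0 | rewrite coef0].
  - exists (p + q); split; [exact: idlD | | by rewrite coefD px qx].
    by rewrite (leq_trans (size_polyD _ _)) // geq_max sp.
  - exists (c%:P * p); split; [exact: idlM | | by rewrite coefCM px].
    by rewrite mul_polyC (leq_trans (size_scale_leq _ _)).
have : (size (f n - q)%R < size (f n))%N.
  rewrite -[X in (_ < X)%N](prednK fn0) ltnS; apply/leq_sizeP => j.
  rewrite leq_eqVlt => /predU1P[<-|]; rewrite coefB; first by rewrite qn subrr.
  rewrite prednK // => ltj; rewrite !nth_default ?subrr //.
  exact: leq_trans szq ltj.
rewrite ltnNge => /negP; apply; apply: f_min.
  rewrite -mulN1r; apply: idlD => //; apply: idlM.
  by apply: idl_sub qst => y /stP.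
move=> fq; apply: (f_st n); rewrite -[f n](subrK q); exact: idlD.
Qed.

(** * k-algebras and localization *)

(** Polynomials are taken over nonzero rings, while a [kalg] may be zero: hence the case
    distinctions on 1 = 0 below. *)
Definition nz_ring (R : comPzRingType) (R1 : 1 != 0 :> R) : comNzRingType :=
  HB.pack (R : Type) R (GRing.PzSemiRing_isNonZero.Build R R1).

Lemma zero_ringE (R : pzRingType) (x y : R) : 1 = 0 :> R -> x = y.
Proof. by move=> R0; rewrite -[x]mul1r -[y]mul1r R0 !mul0r. Qed.

(** Each element of s adds to T one polynomial variable, evaluated at that element, so Hilbert's
    theorem applies at every stage. If s generates R over k, then g is surjective. *)
Lemma noetherian_cover (k : fieldType) (R : comNzRingType)
    (f : {rmorphism k -> R}) (s : seq R) :
  exists (T : comNzRingType) (g : {rmorphism T -> R}),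
    [/\ noetherian T, forall c, exists t, g t = f c
      & forall x, x \in s -> exists t, g t = x].
Proof.
elim: s => [|x s [T [g [nT gf gs]]]].
  by exists k, f; split=> // [|c]; [exact: noetherian_field | exists c].
have cgx : commr_rmorph g x by move=> t; exact: mulrC.
exists {poly T}, (horner_morph cgx : {rmorphism _ -> _}).
split=> [|c|y]; first exact: noetherian_poly.
- by have [t <-] := gf c; exists t%:P; exact: horner_morphC.
- rewrite inE => /predU1P[->|/gs[t <-]]; first by exists 'X; exact: horner_morphX.
  by exists t%:P; exact: horner_morphC.
Qed.

Lemma noetherian_finitely_generated (k : fieldType) (A : kalg k) :
  finitely_generated A -> noetherian A.
Proof.
case=> s sA; have [A0|A1] := eqVneq (1 : A) 0.
  by move=> P; exists [::] => // x _; rewrite (zero_ringE x 0 A0); exact: idl0.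
have [T [g [nT gk gs]]] :=
  @noetherian_cover k (nz_ring A1) (kstr A : {rmorphism k -> nz_ring A1}) s.
apply: (@noetherian_surj T (nz_ring A1) g) nT => y.
apply: (sA (fun y => exists x, g x = y)) => // _ _ [a <-] [b <-].
  by exists (a + b); rewrite rmorphD.
by exists (a * b); rewrite rmorphM.
Qed.

Section KAlgebras.
Context {k : fieldType}.
Implicit Types A B K : kalg k.

(** Serves maps obtained by choice, known only through equations. That 1 goes to 1 follows from
    compatibility with k. *)
Lemma make_khom A B (f : A -> B) :
  {morph f : x y / x + y} -> {morph f : x y / x * y} ->
  (forall c, f (kstr A c) = kstr B c) ->
  exists g : khom A B, g =1 f.
Proof.
move=> fD fM fk.
have f1 : f 1 = 1 by rewrite -(rmorph1 (kstr A)) fk rmorph1.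
have f0 : f 0 = 0 by rewrite -(rmorph0 (kstr A)) fk rmorph0.
have fB : {morph f : x y / x - y}.
  move=> x y; apply: (addIr (f y)).
  by rewrite -fD !subrK.
pose Mf := GRing.isZmodMorphism.Build A B f fB.
pose Mf' := GRing.isMonoidMorphism.Build A B f (conj f1 fM).
pose g : {rmorphism A -> B} := HB.pack f Mf Mf'.
by exists (@KHom k A B g fk).
Qed.

Lemma khom_compE A B K (g : khom B K) (f : khom A B) x :
  khom_comp g f x = g (f x).
Proof. by []. Qed.

Lemma khom_comp_idr A B (f : khom A B) : khom_comp f (khom_id A) = f.
Proof. exact: khom_ext. Qed.

Lemma is_unit_exp A (x y : A) n : x * y = 1 -> x ^+ n * y ^+ n = 1.
Proof. by rewrite -exprMn => ->; rewrite expr1n. Qed.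

(** The fraction l a / (l f)^n must go to h a * u^n; [key] shows that this value depends on the
    fraction alone. *)
Lemma localization_lift A B K (f : A) (l : khom A B) (h : khom A K) :
  is_localization f l -> (exists u, h f * u = 1) ->
  exists h' : khom B K, forall a, h' (l a) = h a.
Proof.
move=> [[v fv] lS l0] [u fu].
have key a n b m : l a * l f ^+ m = l b * l f ^+ n -> h a * u ^+ n = h b * u ^+ m.
  move=> ab; have [p] : exists p, f ^+ p * (a * f ^+ m - b * f ^+ n) = 0.
    by apply: l0; rewrite rmorphB !rmorphM !rmorphXn /= ab subrr.
  move/(congr1 h); rewrite rmorph0 rmorphM rmorphB !rmorphM !rmorphXn /=.
  move=> E; have U q := is_unit_exp q fu.
  rewrite -[LHS]mulr1 -[RHS]mulr1 -(U p) -[LHS]mulr1 -[RHS]mulr1 -{1}(U m) -(U n).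
  apply/eqP; rewrite -subr_eq0; apply/eqP.
  (* Padding with factors (h f)^q * u^q = 1 has turned the difference into a multiple of the left
     side of [E]. *)
  rewrite [LHS](_ : _ = u ^+ p * u ^+ n * u ^+ m *
    (h f ^+ p * (h a * h f ^+ m - h b * h f ^+ n))); last by ring.
  by rewrite E mulr0.
have /choice[phi phiP] : forall b, exists x : K,
    forall a n, b * l f ^+ n = l a -> x = h a * u ^+ n.
  move=> b; have [n [a ba]] := lS b; exists (h a * u ^+ n) => a' n' ba'.
  apply: key; rewrite -ba -ba' -!mulrA; congr (_ * _); exact: mulrC.
have [h' h'E] : exists h' : khom B K, h' =1 phi.
  apply: make_khom => [x y|x y|c].
  - have [n [a xa]] := lS x; have [m [b yb]] := lS y.
    rewrite (phiP x a n xa) (phiP y b m yb).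
    rewrite (phiP (x + y) (a * f ^+ m + b * f ^+ n) (n + m)%N); last first.
      rewrite rmorphD !rmorphM !rmorphXn /= -xa -yb mulrDl exprD.
      by rewrite !mulrA [y * _ * _]mulrAC.
    rewrite rmorphD !rmorphM !rmorphXn /= mulrDl exprD; congr (_ + _).
      rewrite [u ^+ n * _]mulrC -!mulrA; congr (_ * _).
      by rewrite mulrA (is_unit_exp _ fu) mul1r.
    rewrite -!mulrA; congr (_ * _).
    by rewrite mulrA (is_unit_exp _ fu) mul1r.
  - have [n [a xa]] := lS x; have [m [b yb]] := lS y.
    rewrite (phiP x a n xa) (phiP y b m yb) (phiP (x * y) (a * b) (n + m)%N).
      by rewrite rmorphM exprD mulrACA.
    by rewrite exprD rmorphM -xa -yb mulrACA.
  - rewrite (phiP _ (kstr A c) 0%N) ?expr0 ?mulr1 ?khom_str //.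
exists h' => a; rewrite h'E (phiP _ a 0%N) ?expr0 ?mulr1 //.
Qed.

Lemma localization_epi A B K (f : A) (l : khom A B) (g h : khom B K) :
  is_localization f l -> (forall a, g (l a) = h (l a)) -> g = h.
Proof.
move=> [[u fu] lS _] gh; apply: khom_ext => b; have [n [a ba]] := lS b.
have := gh a; rewrite -ba !rmorphM !rmorphXn /= gh.
move/(congr1 (fun x => x * h u ^+ n)); rewrite -!mulrA is_unit_exp ?mulr1 //.
by rewrite -rmorphM fu rmorph1.
Qed.

End KAlgebras.

(** * Construction of A[1/f] as a quotient of pairs *)

Section Localization.
Variables (R : comPzRingType) (f : R).
Implicit Types x y z : R * nat.

(** The pair (a, n) stands for a / f^n. The factor f^p makes the relation transitive even if f is a
    zero divisor. *)
Definition loc_rel : rel (R * nat) :=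
  fun x y => `[< exists p, f ^+ p * (x.1 * f ^+ y.2) = f ^+ p * (y.1 * f ^+ x.2) >].

Lemma loc_rel_refl : reflexive loc_rel.
Proof. by move=> x; apply/asboolP; exists 0%N. Qed.

Lemma loc_rel_sym : symmetric loc_rel.
Proof. by move=> x y; apply/asboolP/asboolP=> -[p xy]; exists p. Qed.

Lemma loc_rel_trans : transitive loc_rel.
Proof.
move=> y x z /asboolP[p xy] /asboolP[q yz]; apply/asboolP.
(* The extra y.2 supplies the factor f^(y.2) that the first hypothesis needs next to x.1. *)
exists (p + q + y.2)%N; rewrite !exprD.
transitivity (f ^+ q * f ^+ z.2 * (f ^+ p * (x.1 * f ^+ y.2))); first by ring.
rewrite xy.
transitivity (f ^+ p * f ^+ x.2 * (f ^+ q * (y.1 * f ^+ z.2))); first by ring.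
by rewrite yz; ring.
Qed.

Canonical loc_equiv := EquivRel loc_rel loc_rel_refl loc_rel_sym loc_rel_trans.

Definition loc : Type := {eq_quot loc_rel}%qT.
HB.instance Definition _ := EqQuotient.on loc.
HB.instance Definition _ := Choice.on loc.

Definition to_loc x : loc := (\pi_loc x)%qT.

Lemma to_locP x y :
  to_loc x = to_loc y <->
  exists p, f ^+ p * (x.1 * f ^+ y.2) = f ^+ p * (y.1 * f ^+ x.2).
Proof. by split=> [/eqmodP/asboolP//|xy]; apply/eqmodP/asboolP. Qed.

Lemma to_loc_surj (b : loc) : exists x, b = to_loc x.
Proof. by exists (repr b); rewrite /to_loc reprK. Qed.

Lemma repr_to_loc x : exists p,
  f ^+ p * ((repr (to_loc x)).1 * f ^+ x.2) =
  f ^+ p * (x.1 * f ^+ (repr (to_loc x)).2).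
Proof. by apply/to_locP; rewrite /to_loc reprK. Qed.

Definition loc_add (a b : loc) : loc := let x := repr a in let y := repr b in
  to_loc (x.1 * f ^+ y.2 + y.1 * f ^+ x.2, (x.2 + y.2)%N).
Definition loc_opp (a : loc) : loc := to_loc (- (repr a).1, (repr a).2).
Definition loc_mul (a b : loc) : loc := let x := repr a in let y := repr b in
  to_loc (x.1 * y.1, (x.2 + y.2)%N).

Lemma loc_addE x y : loc_add (to_loc x) (to_loc y) =
  to_loc (x.1 * f ^+ y.2 + y.1 * f ^+ x.2, (x.2 + y.2)%N).
Proof.
rewrite /loc_add; have [p] := repr_to_loc x; have [q] := repr_to_loc y.
case: (repr (to_loc x)) (repr (to_loc y)) => [a m] [b n].
case: x y => [a' m'] [b' n'] /=.
move=> bE aE; apply/to_locP => /=; exists (p + q)%N; rewrite !exprD.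
transitivity (f ^+ q * f ^+ n * f ^+ n' * (f ^+ p * (a * f ^+ m')) +
  f ^+ p * f ^+ m * f ^+ m' * (f ^+ q * (b * f ^+ n'))); first by ring.
by rewrite aE bE; ring.
Qed.

Lemma loc_oppE x : loc_opp (to_loc x) = to_loc (- x.1, x.2).
Proof.
rewrite /loc_opp; have [p] := repr_to_loc x.
case: (repr (to_loc x)) => a m; case: x => [a' m'] /= aE.
by apply/to_locP => /=; exists p; rewrite !mulNr !mulrN aE.
Qed.

Lemma loc_mulE x y :
  loc_mul (to_loc x) (to_loc y) = to_loc (x.1 * y.1, (x.2 + y.2)%N).
Proof.
rewrite /loc_mul; have [p] := repr_to_loc x; have [q] := repr_to_loc y.
case: (repr (to_loc x)) (repr (to_loc y)) => [a m] [b n].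
case: x y => [a' m'] [b' n'] /=.
move=> bE aE; apply/to_locP => /=; exists (p + q)%N; rewrite !exprD.
transitivity ((f ^+ p * (a * f ^+ m')) * (f ^+ q * (b * f ^+ n'))); first by ring.
by rewrite aE bE; ring.
Qed.

Definition locE := (loc_addE, loc_oppE, loc_mulE).

Lemma to_loc_eq x y : x.1 * f ^+ y.2 = y.1 * f ^+ x.2 -> to_loc x = to_loc y.
Proof. by move=> xy; apply/to_locP; exists 0%N; rewrite xy. Qed.

Fact loc_addA : associative loc_add.
Proof.
move=> a b c; have [x ->] := to_loc_surj a; have [y ->] := to_loc_surj b.
have [z ->] := to_loc_surj c; rewrite !locE.
by apply: to_loc_eq => /=; rewrite !exprD; ring.
Qed.

Fact loc_addC : commutative loc_add.
Proof.
move=> a b; have [x ->] := to_loc_surj a; have [y ->] := to_loc_surj b.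
by rewrite !locE; apply: to_loc_eq => /=; rewrite !exprD; ring.
Qed.

Fact loc_add0 : left_id (to_loc (0, 0%N)) loc_add.
Proof.
move=> a; have [x ->] := to_loc_surj a.
by rewrite !locE; apply: to_loc_eq => /=; rewrite ?exprD expr0; ring.
Qed.

Fact loc_addN : left_inverse (to_loc (0, 0%N)) loc_opp loc_add.
Proof.
move=> a; have [x ->] := to_loc_surj a.
by rewrite !locE; apply: to_loc_eq => /=; rewrite ?exprD expr0; ring.
Qed.

Fact loc_mulA : associative loc_mul.
Proof.
move=> a b c; have [x ->] := to_loc_surj a; have [y ->] := to_loc_surj b.
have [z ->] := to_loc_surj c; rewrite !locE.
by apply: to_loc_eq => /=; rewrite !exprD; ring.
Qed.

Fact loc_mulC : commutative loc_mul.
Proof.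
move=> a b; have [x ->] := to_loc_surj a; have [y ->] := to_loc_surj b.
by rewrite !locE; apply: to_loc_eq => /=; rewrite !exprD; ring.
Qed.

Fact loc_mul1 : left_id (to_loc (1, 0%N)) loc_mul.
Proof.
move=> a; have [x ->] := to_loc_surj a.
by rewrite !locE; apply: to_loc_eq => /=; rewrite ?add0n; ring.
Qed.

Fact loc_mulD : left_distributive loc_mul loc_add.
Proof.
move=> a b c; have [x ->] := to_loc_surj a; have [y ->] := to_loc_surj b.
have [z ->] := to_loc_surj c; rewrite !locE.
by apply: to_loc_eq => /=; rewrite !exprD; ring.
Qed.

HB.instance Definition _ :=
  GRing.isZmodule.Build loc loc_addA loc_addC loc_add0 loc_addN.
HB.instance Definition _ :=
  GRing.Zmodule_isComPzRing.Build loc loc_mulA loc_mulC loc_mul1 loc_mulD.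

Definition loc_tofrac (a : R) : loc := to_loc (a, 0%N).

Fact loc_tofrac_zmod_morphism : zmod_morphism loc_tofrac.
Proof.
move=> a b; rewrite -[RHS]/(loc_add (loc_tofrac a) (loc_opp (loc_tofrac b))).
rewrite loc_oppE loc_addE.
by apply: to_loc_eq => /=; rewrite !expr0; ring.
Qed.

Fact loc_tofrac_monoid_morphism : monoid_morphism loc_tofrac.
Proof.
split=> // a b.
by rewrite -[RHS]/(loc_mul (loc_tofrac a) (loc_tofrac b)) !locE.
Qed.

HB.instance Definition _ :=
  GRing.isZmodMorphism.Build R loc loc_tofrac loc_tofrac_zmod_morphism.
HB.instance Definition _ :=
  GRing.isMonoidMorphism.Build R loc loc_tofrac loc_tofrac_monoid_morphism.

End Localization.

Lemma localization_exists (k : fieldType) (A : kalg k) (f : A) :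
  exists B (l : khom A B), is_localization f l.
Proof.
pose B := @KAlg k (loc f) (loc_tofrac f \o kstr A : {rmorphism _ -> _}).
pose l : khom A B := @KHom k A B (loc_tofrac f : {rmorphism _ -> _}) (fun c => erefl).
have lM (x : A * nat) : to_loc f x * l f ^+ x.2 = l x.1.
  rewrite -rmorphXn /= /loc_tofrac [LHS]loc_mulE /=.
  by apply: to_loc_eq; rewrite /= addn0 expr0 mulr1.
exists B, l; split=> [|b|a].
- exists (to_loc f (1, 1%N)); have := lM (1, 1%N); rewrite /= expr1 mulrC => ->.
  exact: (rmorph1 l).
- by have [x ->] := to_loc_surj b; exists x.2, x.1.
- by move=> /(to_locP f (a, _) (0, _))[p /=]; rewrite !mulr1 mulr0; exists p.
Qed.

Lemma localization_finitely_generated (k : fieldType) (A B : kalg k) (f : A)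
    (l : khom A B) :
  is_localization f l -> finitely_generated A -> finitely_generated B.
Proof.
move=> [[u fu] lS _] [s sA]; exists (u :: [seq l x | x <- s]) => P Pk PD PM Ps b.
have Pl a : P (l a).
  apply: (sA (fun a => P (l a))) => [c|x y|x y|x xs].
  - by rewrite khom_str.
  - by rewrite rmorphD; exact: PD.
  - by rewrite rmorphM; exact: PM.
  - by apply: Ps; rewrite inE map_f ?orbT.
have Pu n : P (u ^+ n).
  elim: n => [|n IH]; first by rewrite expr0 -(rmorph1 l).
  by rewrite exprS; apply: PM => //; apply: Ps; exact: mem_head.
have [n [a ba]] := lS b; rewrite -[b]mulr1 -(is_unit_exp n fu) mulrA ba.
exact: PM.
Qed.

(** * Open subschemes *)

Lemma idl_unit (R : comPzSemiRingType) (P : R -> Prop) x u :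
  idl P x -> x * u = 1 -> idl P 1.
Proof. by move=> Px <-; rewrite mulrC; exact: idlM. Qed.

Lemma idl_singleton (R : comPzSemiRingType) (g : R) :
  idl (eq^~ g) 1 -> exists u, g * u = 1.
Proof.
suff H x : idl (eq^~ g) x -> exists u, g * u = x by exact: H.
elim=> [y ->||y z _ [u <-] _ [v <-]|a y _ [u <-]].
- by exists 1; rewrite mulr1.
- by exists 0; rewrite mulr0.
- by exists (u + v); rewrite mulrDr.
- by exists (a * u); rewrite mulrCA.
Qed.

Arguments fmap {k} X {A B} _ _ : rename.

Section Opens.
Context {k : fieldType}.
Implicit Types (A B K : kalg k) (X Y : kfunctor (k := k)).

(** Every element of the extended ideal is a fraction c / f^n with c in the ideal of I; comparing it
    with a / 1 costs a further power of f. *)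
Lemma localization_idl A B (f : A) (l : khom A B) (I : A -> Prop) a :
  is_localization f l -> idl (l @` I) (l a) -> exists n, idl I (f ^+ n * a).
Proof.
move=> [_ lS l0]; suff H b : idl (l @` I) b ->
    exists n c, b * l f ^+ n = l c /\ idl I c.
  move=> /H[n [c [ac Ic]]]; have [p] : exists p, f ^+ p * (a * f ^+ n - c) = 0.
    by apply: l0; rewrite rmorphB rmorphM rmorphXn /= ac subrr.
  rewrite mulrBr => /eqP; rewrite subr_eq0 => /eqP pE; exists (p + n)%N.
  by rewrite exprD -mulrA [_ * a]mulrC pE; exact: idlM.
elim=> [_ [c Ic <-]||x y _ [n [c [xc Ic]]] _ [m [d [yd Id]]]|x y _ [m [d [yd Id]]]].
- by exists 0%N, c; rewrite expr0 mulr1; split=> //; exact: idl_mem.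
- by exists 0%N, 0; rewrite mul0r rmorph0; split=> //; exact: idl0.
- exists (n + m)%N, (f ^+ m * c + f ^+ n * d); split; last first.
    by apply: idlD; exact: idlM.
  by rewrite rmorphD !rmorphM !rmorphXn /= -xc -yd exprD; ring.
- have [n [c xc]] := lS x; exists (n + m)%N, (c * d); split; last exact: idlM.
  by rewrite rmorphM -xc -yd exprD; ring.
Qed.

Lemma open_subP X (U : subfunctor X) :
  open_sub U <-> forall A (x : X A), exists I : A -> Prop,
    forall B (f : khom A B), U B (fmap X f x) <-> idl (f @` I) 1.
Proof.
by split=> UO A x; have [I UI] := UO A x; exists I => B f;
  rewrite UI generates_unit_idealP.
Qed.

(** The inverse image of U in Spec A is some D(I). If it contains D(c), then a power of c lies in
    the ideal of I, and the elements c generate 1. *)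
Lemma open_sub_local X (U : subfunctor X) A (x : X A) (P : A -> Prop) :
  open_sub U -> idl P 1 ->
  (forall c, P c -> exists B (l : khom A B),
     is_localization c l /\ U B (fmap X l x)) -> U A x.
Proof.
move=> /open_subP UO P1 Ploc; have [I UI] := UO A x.
rewrite -[x]fmap_id UI; apply: (@idl_sub A I) => [c Ic|].
  by apply: idl_mem; exists c.
apply: idl_radical P1 => c /Ploc[B [l [cl /UI]]]; rewrite -(rmorph1 l).
by case/(localization_idl cl) => n; rewrite mulr1; exists n.
Qed.

Lemma mor_ext X Y (f g : mor X Y) : (forall A x, f A x = g A x) -> f = g.
Proof.
case: f g => f fn [g gn] /= fg.
have E : f = g by apply: functional_extensionality_dep => A; apply/funext/fg.
by subst g; congr Mor; exact: Prop_irrelevance.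
Qed.

Fact basic_open_fmap X A (j : mor (Spec A) X) (g : A) B K (h : khom B K)
    (x : X B) :
  (exists2 f : khom A B, j B f = x & exists u, f g * u = 1) ->
  exists2 f : khom A K, j K f = fmap X h x & exists u, f g * u = 1.
Proof.
case=> f <- [u fu]; exists (khom_comp h f); first exact: (mor_nat j h f).
by exists (h u); rewrite khom_compE -rmorphM fu rmorph1.
Qed.

Definition basic_open X A (j : mor (Spec A) X) (g : A) : subfunctor X :=
  SubFunctor (@basic_open_fmap X A j g).

(** Openness is transitive: D(g) is open in Spec A, which is open in X. The difficulty is to produce
    an ideal on a test algebra R whose point factors through j only locally. *)
Lemma basic_open_open X A (j : mor (Spec A) X) (g : A) :
  open_immersion j -> open_sub (basic_open j g).
Proof.
move=> [jmono jO]; apply/open_subP => R x; have [J JP] := (open_subP _).1 jO R x.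
(* I collects the a for which x sends D(a) into the basic open set. *)
pose I a := exists S (l : khom R S),
  is_localization a l /\ basic_open j g S (fmap X l x).
have jM B K (m : khom B K) f : fmap X m (j B f) = j K (khom_comp m f).
  by rewrite -(mor_nat j).
exists I => B h; split=> [[f jf [u fu]]|I1].
  have /JP J1 : mor_image j B (fmap X h x) by exists f.
  apply: idl_radical J1 => _ [r Jr <-].
  have [S [l rl]] := localization_exists r.
  have [v rv] : exists u, l r * u = 1 by case: rl.
  have /JP[fr jfr] : idl (l @` J) 1.
    by apply: idl_unit rv; apply: idl_mem; exists r.
  (* On D(r) the point x factors through j and g pulls back to a / r^n, which is invertible on D(a *
     r). The factor r keeps this set inside D(r). *)
  have [n [a fra]] : exists n a, fr g * l r ^+ n = l a by case: rl.
  have Iar : I (a * r).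
    have [T [t art]] := localization_exists (a * r).
    exists T, t; split=> //; have [w] : exists u, t (a * r) * u = 1 by case: art.
    rewrite rmorphM => arw.
    have [t' t'l] : exists t' : khom S T, forall a, t' (l a) = t a.
      by apply: localization_lift rl _; exists (t a * w); rewrite -arw; ring.
    have -> : fmap X t x = fmap X t' (fmap X l x).
      by rewrite -fmap_comp; congr fmap; apply: khom_ext => b; rewrite khom_compE t'l.
    exists (khom_comp t' fr); first by rewrite -jfr jM.
    exists (t r ^+ n * t r * w); rewrite khom_compE -arw -(t'l a) -fra.
    by rewrite rmorphM rmorphXn /= !t'l; ring.
  have [S' [m rm]] := localization_exists (h r).
  have [h' h'l] : exists h' : khom S S', forall a, h' (l a) = khom_comp m h a.
    by apply: localization_lift rl _; case: rm.
  have E : khom_comp h' fr = khom_comp m f.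
    apply: jmono; rewrite -!jM jf jfr -!fmap_comp; congr fmap.
    by apply: khom_ext => b; rewrite khom_compE h'l.
  have [p] : exists p, h r ^+ p * (h a - f g * h r ^+ n) = 0.
    case: rm => _ _; apply; rewrite rmorphB rmorphM rmorphXn /=.
    have := congr1 (fun g0 : khom A S' => g0 g) E; rewrite !khom_compE => <-.
    have := h'l a; rewrite khom_compE => <-; rewrite -fra rmorphM rmorphXn /= h'l.
    by rewrite khom_compE subrr.
  (* p comes from an equality of fractions in B[1/h r], n from the denominator of a / r^n, and the
     last factor h r turns h a into h (a * r). *)
  rewrite mulrBr => /eqP; rewrite subr_eq0 => /eqP pE; exists (p + n + 1)%N.
  have -> : h r ^+ (p + n + 1) = h r ^+ p * u * h (a * r).
    rewrite !exprD expr1 -[LHS]mulr1 -fu rmorphM.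
    transitivity (u * h r * (h r ^+ p * (f g * h r ^+ n))); first by ring.
    by rewrite -pE; ring.
  by apply: idlM; apply: idl_mem; exists (a * r).
have Iloc c : (h @` I) c -> exists S (m : khom B S),
    is_localization c m /\ basic_open j g S (fmap X m (fmap X h x)).
  move=> [a [S [l [al lD]]] <-]; have [T [m hm]] := localization_exists (h a).
  exists T, m; split=> //.
  have [t tl] : exists t : khom S T, forall a, t (l a) = khom_comp m h a.
    by apply: localization_lift al _; case: hm.
  have -> : fmap X m (fmap X h x) = fmap X t (fmap X l x).
    by rewrite -!fmap_comp; congr fmap; apply: khom_ext => b; rewrite [RHS]khom_compE tl.
  exact: sub_fmap.
(* Conversely, lying in the image of j is local on B; once the factorization f is found,
   invertibility of f g is tested locally as well. *)
have [f jf] : mor_image j B (fmap X h x).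
  apply: open_sub_local jO I1 _ => c /Iloc[S [m [cm [f jf _]]]].
  by exists S, m; split=> //; exists f.
exists f => //; apply: idl_singleton; apply: idl_radical I1 => c.
case/Iloc => S [m [cm [f' jf' [u fu]]]]; rewrite -jf jM in jf'.
rewrite (jmono _ _ _ jf') khom_compE in fu.
have [|n] := @localization_idl _ _ _ _ (eq^~ (f g)) 1 cm.
  rewrite rmorph1; apply: idl_unit fu; apply: idl_mem; by exists (f g).
by rewrite mulr1; exists n.
Qed.

End Opens.

Lemma dependent_choice (T : Type) (P : T -> Type) (Q : forall t, P t -> Prop) :
  (forall t, exists x, Q t x) -> exists f : forall t, P t, forall t, Q t (f t).
Proof. by move=> H; exists (fun t => sval (cid (H t))) => t; case: cid. Qed.

(** * Open subfunctors of smooth schemes of finite type *)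

Section OpenSubschemes.
Context {k : fieldType}.
Implicit Types (A B K : kalg k) (X Y : kfunctor (k := k)).

Lemma sub_eq X (U : subfunctor X) A (x y : sub_to_functor U A) :
  sval x = sval y -> x = y.
Proof. by case: x y => [x Ux] [y Uy] /= xy; exact: eq_exist. Qed.

Lemma zariski_sheaf_open X (U : subfunctor X) :
  zariski_sheaf X -> open_sub U -> zariski_sheaf U.
Proof.
move=> XS UO A n f B l x f1 lf xx.
have [|y [yx yu]] := XS A n f B l (fun i => sval (x i)) f1 lf.
  by move=> i j K u v uv; exact: (congr1 sval (xx i j K u v uv)).
have Uy : U A y.
  move/generates_unit_idealP: f1 => f1.
  apply: open_sub_local UO f1 _ => _ [i _ <-]; exists (B i), (l i); split=> //.
  by rewrite yx; exact: svalP.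
exists (exist _ y Uy); split=> [i|z zx]; first by apply: sub_eq; rewrite /= yx.
apply: sub_eq => /=; apply: yu => i.
exact: (congr1 sval (zx i)).
Qed.

(** A lift x exists in X, and the inverse image of U along it is D(I). As I generates 1 in B, some a
    in the ideal of I maps to 1; then (1 - a)^2 = 0, so a is a unit with inverse 2 - a and x lies in
    U. *)
Lemma formally_smooth_open X (U : subfunctor X) :
  formally_smooth X -> open_sub U -> formally_smooth U.
Proof.
move=> XS UO A B q qS q0 [y Uy]; have [x xy] := XS A B q qS q0 y.
have Ux : U A x.
  have [I UI] := (open_subP _).1 UO A x.
  rewrite -[x]fmap_id UI; have /UI I1 : U B (fmap X q x) by rewrite xy.
  apply: (@idl_sub A I) => [c Ic|]; first by apply: idl_mem; exists c.
  have H b : idl (q @` I) b -> exists2 a, idl I a & q a = b.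
    elim=> [_ [a Ia <-]||b1 b2 _ [a1 I1' <-] _ [a2 I2 <-]|b1 b2 _ [a2 I2 <-]].
    - by exists a => //; exact: idl_mem.
    - by exists 0; [exact: idl0 | rewrite rmorph0].
    - by exists (a1 + a2); [exact: idlD | rewrite rmorphD].
    - by have [a1 <-] := qS b1; exists (a1 * a2); [exact: idlM | rewrite rmorphM].
  have [a Ia qa] := H _ I1; apply: (@idl_unit _ _ a (1 + (1 - a)) Ia).
  have e2 : (1 - a) * (1 - a) = 0 by apply: q0; rewrite rmorphB qa rmorph1 subrr.
  by transitivity (1 - (1 - a) * (1 - a)); [ring | rewrite e2 subr0].
by exists (exist _ x Ux); apply: sub_eq.
Qed.

Record chart X := Chart {
  chart_alg : kalg k;
  chart_mor :> mor (Spec chart_alg) X;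
  chart_open : open_immersion chart_mor;
  chart_fg : finitely_generated chart_alg }.

(** Any finite index type is allowed, so that covers indexed by pairs (chart, generator) need no
    renumbering. *)
Lemma finite_type_charts X :
  finite_type X <-> exists (T : finType) (c : T -> chart X),
    forall K (x : X K), is_field K -> exists t, mor_image (c t) K x.
Proof.
split=> [[n [A [j [[jO jcov] Afg]]]]|[T [c ccov]]].
  by exists 'I_n, (fun i => Chart (jO i) (Afg i)).
pose c' i := c (@enum_val T predT i).
exists #|T|, (fun i => chart_alg (c' i)), (fun i => chart_mor (c' i)).
split; last by move=> i; exact: chart_fg.
split=> [i|K x Kf]; first exact: chart_open.
have [t xt] := ccov K x Kf; exists (enum_rank t).
by rewrite /c' enum_rankK.
Qed.

Lemma finite_type_scheme X : zariski_sheaf X -> finite_type X -> is_scheme X.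
Proof. by move=> XS [n [A [j [jcov _]]]]; split=> //; exists 'I_n, A, j. Qed.

Lemma Spec_mor X A (j : mor (Spec A) X) B (f : khom A B) :
  j B f = fmap X f (j A (khom_id A)).
Proof. by rewrite -(mor_nat j) /= khom_comp_idr. Qed.

Lemma idl_field K (P : K -> Prop) :
  is_field K -> idl P 1 -> exists x, P x /\ x <> 0.
Proof.
move=> [K1 _] P1; apply: contrapT => /forallNP P0; apply: K1.
elim: P1 => [x Px|//|x y _ -> _ ->|a x _ ->].
- by apply: contrapT => x0; exact: (P0 x).
- by rewrite addr0.
- by rewrite mulr0.
Qed.

Fact restrict_basic_nat X (U : subfunctor X) A (j : mor (Spec A) X) B
    (l : khom A B) (H : forall K (f : khom B K), U K (j K (khom_comp f l)))
    K L (h : khom K L) (f : Spec B K) :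
  exist (U L) (j L (khom_comp (khom_comp h f) l)) (H L (khom_comp h f)) =
  fmap U h (exist (U K) (j K (khom_comp f l)) (H K f)).
Proof. by apply: sub_eq => /=; rewrite Spec_comp -(mor_nat j). Qed.

Lemma basic_chart X (U : subfunctor X) (c : chart X) (g : chart_alg c) :
  (forall K (x : X K), basic_open c g K x -> U K x) ->
  exists c' : chart U, forall K (x : sub_to_functor U K),
    mor_image c' K x <-> basic_open c g K (sval x).
Proof.
case: c g => A j jO Afg /= g gU; have [B [l gl]] := localization_exists g.
have lP K (f : khom B K) : basic_open j g K (j K (khom_comp f l)).
  exists (khom_comp f l) => //; have [[u gu] _ _] := gl; exists (f u).
  by rewrite khom_compE -rmorphM gu rmorph1.
pose j' := @Mor k (Spec B) U
  (fun K f => exist (U K) (j K (khom_comp f l)) (gU _ _ (lP K f)))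
  (@restrict_basic_nat X U A j B l (fun K f => gU _ _ (lP K f))).
have j'E K (x : sub_to_functor U K) : mor_image j' K x <-> basic_open j g K (sval x).
  split=> [[f <-]|[f jf gf]]; first exact: lP.
  have [h hl] := localization_lift gl gf; exists h; apply: sub_eq => /=.
  by rewrite -jf; congr (j K _); exact: khom_ext.
suff j'O : open_immersion j'.
  by exists (Chart j'O (localization_finitely_generated gl Afg)).
split=> [K f h /(congr1 sval) /= fh|].
  apply: localization_epi gl _ => a.
  have := jO.1 _ _ _ fh.
  by move/(congr1 (fun f0 : khom A K => f0 a)).
apply/open_subP => R x.
have [I IP] := (open_subP _).1 (basic_open_open g jO) R (sval x).
by exists I => K h; rewrite j'E -IP.
Qed.

(** U meets each chart in some D(I). The chart algebra is Noetherian, so finitely many g generate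
    the ideal of I and the sets D(g) cover D(I). *)
Lemma finite_type_open X (U : subfunctor X) :
  finite_type X -> open_sub U -> finite_type U.
Proof.
rewrite !finite_type_charts => -[T [c ccov]] UO.
have /dependent_choice[I IP] : forall t, exists I : chart_alg (c t) -> Prop,
    forall K (f : khom (chart_alg (c t)) K), U K (c t K f) <-> idl (f @` I) 1.
  move=> t; have [I IP] := (open_subP _).1 UO _ (c t _ (khom_id _)).
  by exists I => K f; rewrite -IP Spec_mor.
have /dependent_choice[s sP] : forall t, exists s : seq (chart_alg (c t)),
    (forall g, g \in s -> idl (I t) g) /\ forall g, I t g -> idl (fun y => y \in s) g.
  move=> t; have [s s1 s2] := noetherian_finitely_generated (chart_fg (c t)) (I t).
  by exists s.
pose T' := {t : T & 'I_(size (s t))}.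
have /dependent_choice[c' c'P] : forall p : T', exists c' : chart U,
    forall K (x : sub_to_functor U K),
    mor_image c' K x <-> basic_open (c (tag p)) (s (tag p))`_(tagged p) K (sval x).
  move=> [t i] /=; apply: basic_chart => K _ [f <- [u fu]]; apply/IP.
  apply: (@idl_unit _ _ (f (s t)`_i) u) fu; apply: idl_image.
  by apply: (sP t).1; exact: mem_nth.
exists T', c' => K [x Ux] Kf; have [t [f fx]] := ccov K x Kf.
have I1 : idl (f @` I t) 1 by apply/IP; rewrite fx.
(* Generators whose images generate 1 in a field cannot all vanish there, so the point lies in one
   of the D(g). *)
have [_ [[g gs <-] fg0]] : exists x, (f @` [set g | g \in s t]) x /\ x <> 0.
  apply: idl_field => //; apply: idl_sub I1 => _ [g Ig <-].
  by apply: idl_image; exact: (sP t).2.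
have [u fgu] : exists u, f g * u = 1 by have [_] := Kf; apply.
have gs' : (index g (s t) < size (s t))%N by rewrite index_mem.
exists (Tagged (fun t => 'I_(size (s t))) (Ordinal gs')); apply/c'P => /=.
by exists f => //; exists u; rewrite nth_index.
Qed.

Definition open_Sm (X : Sm k) (U : subfunctor X) (UO : open_sub U) : Sm k :=
  MkSm (finite_type_scheme (zariski_sheaf_open (Sm_scheme X).1 UO)
          (finite_type_open (Sm_finite_type X) UO))
       (finite_type_open (Sm_finite_type X) UO)
       (formally_smooth_open (@Sm_formally_smooth k X) UO).

Definition incl X (U : subfunctor X) : mor U X :=
  @Mor k U X (fun A x => sval x) (fun _ _ _ _ => erefl).

Lemma mor_image_incl X (U : subfunctor X) A (x : X A) :
  mor_image (incl U) A x <-> U A x.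
Proof. by split=> [[[y Uy] <-]//|Ux]; exists (exist _ x Ux). Qed.

Lemma open_immersion_incl X (U : subfunctor X) :
  open_sub U -> open_immersion (incl U).
Proof.
move=> UO; split=> [A x y|]; first exact: sub_eq.
move=> A x; have [I IP] := UO A x; exists I => B f.
by rewrite mor_image_incl IP.
Qed.

Lemma dense_sub_incl X (U : subfunctor X) :
  dense_sub U -> dense_sub (mor_image (incl U)).
Proof.
move=> UD V VO Vp; have [p [Up Vp']] := UD V VO Vp.
by exists p; split=> //; apply/mor_image_incl.
Qed.

End OpenSubschemes.

(** * Affine spaces *)

Section AffineSpace.
Context {k : fieldType}.
Implicit Types (A B K : kalg k) (X Y : kfunctor (k := k)).

(* The elements a of A such that the family (a x_i) descends to A form an
   ideal; it contains a power of each f_j, hence 1. *)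
Lemma ring_zariski_sheaf A n (f : 'I_n -> A) (B : 'I_n -> kalg k)
    (l : forall i, khom A (B i)) (x : forall i, B i) :
  generates_unit_ideal (range f) ->
  (forall i, is_localization (f i) (l i)) ->
  (forall i j (K : kalg k) (u : khom (B i) K) (v : khom (B j) K),
      (forall a, u (l i a) = v (l j a)) -> u (x i) = v (x j)) ->
  exists! y : A, forall i, l i y = x i.
Proof.
move=> /generates_unit_idealP f1 lf xx.
have [y yx] : exists y, forall i, l i y = x i.
  pose J a := exists y, forall i, l i y = l i a * x i.
  suff [y yx] : J 1 by exists y => i; rewrite yx rmorph1 mul1r.
  have J_idl a : idl J a -> J a.
    elim=> [//||b c _ [y yb] _ [z zc]|b c _ [z zc]].
    - by exists 0 => i; rewrite rmorph0 mul0r.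
    - by exists (y + z) => i; rewrite !rmorphD mulrDl yb zc.
    - by exists (b * z) => i; rewrite !rmorphM zc mulrA.
  apply: J_idl; apply: idl_radical f1 => _ [j _ <-].
  have [m [b xb]] : exists m b, x j * l j (f j) ^+ m = l j b by case: (lf j).
  (* b represents f_j^m x_j. By compatibility, l_i b and f_j^m x_i agree in B_i[1/f_j], so a power
     of f_j kills their difference; the sum of these exponents then serves for all i. *)
  have /choice[p pP] : forall i, exists p,
      l i (f j) ^+ p * (l i b - l i (f j) ^+ m * x i) = 0.
    move=> i; have [K [u uf]] := localization_exists (l i (f j)).
    have [v vE] : exists v : khom (B j) K, forall a, v (l j a) = khom_comp u (l i) a.
      by apply: localization_lift (lf j) _; case: uf.
    case: uf => _ _; apply; rewrite rmorphB rmorphM rmorphXn /=.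
    have -> : u (l i b) = v (l j b) by rewrite vE.
    rewrite -xb rmorphM rmorphXn /= vE khom_compE -(xx i j K u v) => [|a].
      by rewrite mulrC subrr.
    by rewrite vE.
  exists (\sum_i p i + m)%N; apply: idl_mem; exists (f j ^+ (\sum_i p i) * b) => i.
  rewrite !rmorphM !rmorphXn /=; apply/eqP; rewrite -subr_eq0; apply/eqP.
  rewrite (bigD1 i) //= !exprD.
  transitivity (l i (f j) ^+ (\sum_(j | j != i) p j) *
    (l i (f j) ^+ p i * (l i b - l i (f j) ^+ m * x i))); first by ring.
  by rewrite pP mulr0.
exists y; split=> // z zx; apply/eqP; rewrite -subr_eq0 -[y - z]mul1r; apply/eqP.
pose J a := a * (y - z) = 0.
have J_idl a : idl J a -> J a.
  rewrite /J; elim=> [//||b c _ yb _ zc|b c _ zc]; first by rewrite mul0r.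
    by rewrite mulrDl yb zc addr0.
  by rewrite -mulrA zc mulr0.
apply: J_idl; apply: idl_radical f1 => _ [j _ <-].
have [p pP] : exists p, f j ^+ p * (y - z) = 0.
  by case: (lf j) => _ _; apply; rewrite rmorphB yx zx subrr.
by exists p; exact: idl_mem.
Qed.

Lemma zariski_sheaf_affine_space n : zariski_sheaf (affine_space (k := k) n).
Proof.
move=> A m f B l x f1 lf xx.
have /choice[y yP] : forall j, exists y : A, (forall i, l i y = x i 0 j) /\
    forall z, (forall i, l i z = x i 0 j) -> y = z.
  move=> j; have [|y [yx yu]] := @ring_zariski_sheaf A m f B l (fun i => x i 0 j) f1 lf.
    move=> i i' K u v uv; have /rowP/(_ j) := xx i i' K u v uv.
    by rewrite !mxE.
  by exists y.
exists (\row_j y j); split=> [i|z zx].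
  by apply/rowP => j; rewrite !mxE; exact: (yP j).1.
apply/rowP => j; rewrite mxE; apply: (yP j).2 => i; have /rowP/(_ j) := zx i.
by rewrite mxE.
Qed.

Lemma zariski_sheaf_kprod X Y :
  zariski_sheaf X -> zariski_sheaf Y -> zariski_sheaf (kprod X Y).
Proof.
move=> XS YS A n f B l x f1 lf xx.
have [|y [yx yu]] := XS A n f B l (fun i => (x i).1) f1 lf.
  by move=> i j K u v uv; exact: (congr1 fst (xx i j K u v uv)).
have [|z [zx zu]] := YS A n f B l (fun i => (x i).2) f1 lf.
  by move=> i j K u v uv; exact: (congr1 snd (xx i j K u v uv)).
exists (y, z); split=> [i|[y' z'] yz'] /=; first by rewrite yx zx; case: (x i).
rewrite (yu y') ?(zu z') // => i; first exact: (congr1 snd (yz' i)).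
exact: (congr1 fst (yz' i)).
Qed.

Lemma formally_smooth_affine_space n : formally_smooth (affine_space (k := k) n).
Proof.
move=> A B q qS _ y; have /choice[x xy] : forall j, exists a, q a = y 0 j.
  by move=> j; exact: qS.
by exists (\row_j x j); apply/rowP => j; rewrite !mxE xy.
Qed.

Lemma formally_smooth_kprod X Y :
  formally_smooth X -> formally_smooth Y -> formally_smooth (kprod X Y).
Proof.
move=> XS YS A B q qS q0 [x y]; have [a ax] := XS A B q qS q0 x.
by have [b bx] := YS A B q qS q0 y; exists (a, b); rewrite /= ax bx.
Qed.

(** A[t] by its universal property, which makes sense also for the zero ring, where A itself
    serves. *)
Lemma polynomial_algebra1 A : exists P (c : khom A P) (t : P),
  [/\ finitely_generated A -> finitely_generated P,
    forall B (u : khom A B) b, exists2 h : khom P B, khom_comp h c = u & h t = b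
  & forall B (g h : khom P B),
      khom_comp g c = khom_comp h c -> g t = h t -> g = h].
Proof.
have [A0|A1] := eqVneq (1 : A) 0.
  have B0 B (u : khom A B) : 1 = 0 :> B by rewrite -(rmorph1 u) A0 rmorph0.
  exists A, (khom_id A), 0; split=> // [B u b|B g h _ _].
    by exists u; [exact: khom_comp_idr | exact: zero_ringE (B0 B u)].
  by apply: khom_ext => a; exact: zero_ringE (B0 B g).
pose R := nz_ring A1.
pose P := @KAlg k {poly R} (polyC \o (kstr A : {rmorphism k -> R}) : {rmorphism _ -> _}).
pose c := @KHom k A P (polyC : {rmorphism R -> {poly R}}) (fun=> erefl).
exists P, c, 'X; split=> [[s sA]|B u b|B g h gh gX].
- exists ('X :: [seq c a | a <- s]) => Q Qk QD QM Qs p.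
  have Qc a : Q (c a).
    apply: (sA (fun a => Q (c a))) => [e|x y|x y|x xs].
    + by have := Qk e.
    + by rewrite rmorphD; exact: QD.
    + by rewrite rmorphM; exact: QM.
    + by apply: Qs; rewrite inE map_f ?orbT.
  elim/poly_ind: p => [|p a Qp]; first by rewrite -(rmorph0 c); exact: Qc.
  apply: QD; last exact: (Qc a).
  by apply: QM => //; apply: Qs; exact: mem_head.
- have [B0|B1] := eqVneq (1 : B) 0.
    have E (x y : B) : x = y := zero_ringE x y B0.
    have [h _] := @make_khom k P B (fun=> 0)
      (fun _ _ => E _ _) (fun _ _ => E _ _) (fun _ => E _ _).
    by exists h => //; apply: khom_ext.
  pose S := nz_ring B1.
  have cu : commr_rmorph (u : {rmorphism R -> S}) (b : S) by move=> a; exact: mulrC.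
  pose f : {rmorphism {poly R} -> S} := horner_morph cu.
  have [h hE] : exists h : khom P B, h =1 f.
    apply: make_khom => [x y|x y|e]; [exact: (rmorphD f)|exact: (rmorphM f)|].
    by rewrite -(khom_str u); exact: (horner_morphC cu).
  exists h; last by rewrite hE; exact: (horner_morphX cu).
  by apply: khom_ext => a; rewrite khom_compE hE; exact: (horner_morphC cu).
- apply: khom_ext; elim/poly_ind => [|p a IH]; first by rewrite !rmorph0.
  rewrite -[LHS]/(g ((p : P) * 'X + c a)) -[RHS]/(h ((p : P) * 'X + c a)).
  rewrite !rmorphD !rmorphM /= IH gX; congr (_ + _).
  exact: (congr1 (fun f : khom A B => f a) gh).
Qed.

(** The variables are indexed by [nat], with only those below n constrained, so that the induction
    adds t n without reindexing the others. *)
Lemma polynomial_algebra A n : exists P (c : khom A P) (t : nat -> P),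
  [/\ finitely_generated A -> finitely_generated P,
    forall B (u : khom A B) (b : nat -> B), exists2 h : khom P B,
      khom_comp h c = u & forall i, (i < n)%N -> h (t i) = b i
  & forall B (g h : khom P B),
      khom_comp g c = khom_comp h c ->
      (forall i, (i < n)%N -> g (t i) = h (t i)) -> g = h].
Proof.
elim: n => [|n [P [c [t [Pfg Pex Puniq]]]]].
  exists A, (khom_id A), (fun=> 0); split=> // [B u b|B g h].
    by exists u => //; exact: khom_comp_idr.
  by rewrite !khom_comp_idr.
have [Q [d [X [Qfg Qex Quniq]]]] := polynomial_algebra1 P.
exists Q, (khom_comp d c), (fun i => if i == n then X else d (t i)).
split=> [/Pfg/Qfg//|B u b|B g h gh gth].
  have [h hc ht] := Pex B u b; have [h' h'd h'X] := Qex B h (b n).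
  exists h' => [|i]; first by rewrite -Spec_comp h'd.
  rewrite ltnS leq_eqVlt; case: eqP => [-> _|_ /= ltin] //.
  by rewrite -ht // -h'd.
apply: Quniq; last by have := gth n (ltnSn n); rewrite eqxx.
apply: Puniq => [|i ltin]; first by rewrite !Spec_comp.
have := gth i (ltnW ltin); rewrite (ltn_eqF ltin) => gthi.
exact: gthi.
Qed.

Fact affine_chart_nat X n P A (c : khom A P) (t : nat -> P)
    (j : mor (Spec A) X) K L (h : khom K L) (f : Spec P K) :
  (\row_(i < n) khom_comp h f (t i), j L (khom_comp (khom_comp h f) c)) =
  fmap (kprod (affine_space n) X) h
    (\row_(i < n) f (t i), j K (khom_comp f c)).
Proof.
congr pair; first by apply/rowP => i; rewrite !mxE.
by rewrite Spec_comp -(mor_nat j).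
Qed.

(** The charts are Spec A[t_0, ..., t_(n-1)]. Each is open because its image is the inverse image
    under the projection of the image of a chart of X. *)
Lemma finite_type_affine_space n X :
  finite_type X -> finite_type (kprod (affine_space n) X).
Proof.
rewrite !finite_type_charts => -[T [c ccov]].
suff /dependent_choice[c' c'P] : forall t, exists c' : chart (kprod (affine_space n) X),
    forall K v x, mor_image (c t) K x -> mor_image c' K (v, x).
  by exists T, c' => K [v x] /(ccov K x)[t xt]; exists t; exact: c'P.
move=> t0; case: (c t0) => A j [jmono jO] Afg /=.
have [P [d [t [Pfg Pex Puniq]]]] := polynomial_algebra A n.
pose j' := @Mor k (Spec P) (kprod (affine_space n) X)
  (fun K (f : khom P K) => (\row_(i < n) f (t i), j K (khom_comp f d)))
  (@affine_chart_nat X n P A d t j).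
have j'E K v x : mor_image j' K (v, x) <-> mor_image j K x.
  split=> [[f [_ <-]]|[f <-]]; first by exists (khom_comp f d).
  have [h hd ht] := Pex K f (fun i => if insub i is Some i0 then v 0 i0 else 0).
  exists h; rewrite /= hd; congr pair; apply/rowP => i; rewrite mxE ht //.
  by rewrite valK.
have j'O : open_immersion j'.
  split=> [K f g [/rowP fgt /jmono fgd]|].
    by apply: Puniq => // i ltin; have := fgt (Ordinal ltin); rewrite !mxE.
  move=> R [v x]; have [I IP] := jO R x; exists I => B f.
  by rewrite j'E IP.
by exists (Chart j'O (Pfg Afg)) => K v x xt; apply/j'E.
Qed.

Definition affine_space_Sm n (X : Sm k) : Sm k :=
  MkSm (finite_type_scheme
          (zariski_sheaf_kprod (@zariski_sheaf_affine_space n) (Sm_scheme X).1)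
          (finite_type_affine_space n (Sm_finite_type X)))
       (finite_type_affine_space n (Sm_finite_type X))
       (formally_smooth_kprod (@formally_smooth_affine_space n)
          (@Sm_formally_smooth k X)).

End AffineSpace.

(** * Birational presheaves *)

Section Invariance.
Context {k : fieldType}.
Implicit Types (A B K : kalg k) (X Y : kfunctor (k := k)).

Lemma open_sub_ext X (U V : subfunctor X) :
  (forall A (x : X A), U A x <-> V A x) -> open_sub U -> open_sub V.
Proof.
by move=> UV UO A x; have [I IP] := UO A x; exists I => B f; rewrite -IP UV.
Qed.

Lemma dense_sub_ext X (U V : subfunctor X) :
  (forall A (x : X A), U A x <-> V A x) -> dense_sub U -> dense_sub V.
Proof.
move=> UV UD W WO Wp; have [p [Up Wp']] := UD W WO Wp.
by exists p; split=> //; apply/UV.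
Qed.

(** P = K[t] and L = K(t): an affine line over K with its K-points and its generic point, used to
    move a point away from x = 0. *)
Lemma generic_line K : is_field K ->
  exists (P L : kalg k) (c : khom K P) (t : P) (q : khom P L),
    [/\ is_field L, forall p, q p = 0 -> p = 0, t <> 0
      & forall a : K, exists2 ev : khom P K, khom_comp ev c = khom_id K & ev t = a].
Proof.
move=> [/eqP K1 Kinv]; pose R := nz_ring K1.
(* The value 0 at x = 0 is the convention of the field structure built next. *)
have /choice[inv invP] : forall x : K, exists y,
    (x != 0 -> y * x = 1) /\ (x = 0 -> y = 0).
  move=> x; have [->|/eqP x0] := eqVneq x 0; first by exists 0.
  by have [y xy] := Kinv x x0; exists y; split=> // _; rewrite mulrC.
pose F : fieldType := HB.pack (R : Type) R
  (GRing.ComNzRing_isField.Build R (fun x => (invP x).1) ((invP 0).2 erefl)).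
pose P := @KAlg k {poly F} (polyC \o (kstr K : {rmorphism k -> F}) : {rmorphism _ -> _}).
pose L := @KAlg k {fraction {poly F}}
  (@tofrac {poly F} \o (kstr P : {rmorphism k -> {poly F}}) : {rmorphism _ -> _}).
pose c := @KHom k K P (polyC : {rmorphism F -> {poly F}}) (fun=> erefl).
pose q := @KHom k P L
  (@tofrac {poly F} : {rmorphism {poly F} -> {fraction {poly F}}}) (fun=> erefl).
exists P, L, c, 'X, q; split.
- split=> [|x x0]; first by apply/eqP; exact: (oner_neq0 {fraction {poly F}}).
  by exists (x^-1 : {fraction {poly F}}); apply: mulfV; exact/eqP.
- by move=> p /eqP; rewrite tofrac_eq0 => /eqP.
- by move/eqP; rewrite polyX_eq0.
- move=> a; have evk (e : k) : horner_eval (a : F) (kstr P e) = kstr K e.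
    exact: hornerC.
  exists (@KHom k P K (horner_eval (a : F) : {rmorphism {poly F} -> F}) evk).
    by apply: khom_ext => x; exact: (@hornerC F x a).
  exact: (@hornerX F a).
Qed.

Fact nonvanishing_fmap Y A B (f : khom A B) (p : kprod (affine_space 1) Y A) :
  (exists u, p.1 0 0 * u = 1) ->
  exists u, (fmap (kprod (affine_space 1) Y) f p).1 0 0 * u = 1.
Proof. by case=> u pu; exists (f u); rewrite mxE -rmorphM pu rmorph1. Qed.

Definition nonvanishing Y : subfunctor (kprod (affine_space 1) Y) :=
  SubFunctor (@nonvanishing_fmap Y).

Lemma nonvanishing_open Y : open_sub (nonvanishing Y).
Proof.
apply/open_subP => A p; exists (eq^~ (p.1 0 0)) => B f; split=> /= [[u]|I1].
  by rewrite mxE; apply: idl_unit; apply: idl_mem; exists (p.1 0 0).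
rewrite mxE; apply: idl_singleton; apply: idl_sub I1 => _ [_ -> <-].
exact: idl_mem.
Qed.

(** The line w through (v, y) in the direction of x meets V at t = v, so its generic point lies in
    V; there x = t is nonzero. *)
Lemma nonvanishing_dense Y : dense_sub (nonvanishing Y).
Proof.
move=> V VO [[K Kf [v y]] /= Vp].
have [P [L [c [t [q [Lf q0 t0 evP]]]]]] := generic_line Kf.
have [ev evc evt] := evP (v 0 0).
pose w : kprod (affine_space 1) Y P := (const_mx t, fmap Y c y).
have [I IP] := (open_subP _).1 VO P w.
(* V pulls back to D(I) on the line; a polynomial p in I with p(v) <> 0 is nonzero, hence invertible
   at the generic point. *)
have [_ [[p Ip <-] p0]] : exists x, (ev @` I) x /\ x <> 0.
  apply: idl_field => //; apply/IP; rewrite /= -fmap_comp evc fmap_id.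
  suff -> : map_mx ev (const_mx t) = v by [].
  by apply/rowP => i; rewrite !mxE evt ord1.
have qp : q p <> 0 by move/q0 => p00; apply: p0; rewrite p00 rmorph0.
exists (Pt Lf (fmap (kprod (affine_space 1) Y) q w)); split=> /=.
  by rewrite /pts /= mxE; apply: Lf.2 => /q0; rewrite mxE.
apply/IP; have [u qu] := Lf.2 _ qp.
by apply: idl_unit qu; apply: idl_mem; exists p.
Qed.

(** * The scaling map b and its restriction to x <> 0 *)

Section Scaling.
Variables (n : nat) (Z : Sm k).
Let M := affine_space_Sm n Z.
Let B := affine_space_Sm 1 M.

Fact scaling_nat A A' (f : khom A A') (p : B A) :
  ((fmap B f p).1, ((fmap B f p).1 0 0 *: (fmap B f p).2.1, (fmap B f p).2.2)) =
  fmap B f (p.1, (p.1 0 0 *: p.2.1, p.2.2)).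
Proof.
by congr (_, (_, _)); apply/rowP => i; rewrite !mxE rmorphM.
Qed.

Definition scaling : mor B B :=
  @Mor k B B (fun A p => (p.1, (p.1 0 0 *: p.2.1, p.2.2))) scaling_nat.

Fact zero_section_nat m (Y : Sm k) A A' (f : khom A A') (y : Y A) :
  (0, fmap Y f y) = fmap (affine_space_Sm m Y) f (0 : 'rV[A]_m, y).
Proof. by congr pair; apply/rowP => i; rewrite !mxE rmorph0. Qed.

Definition zero_section m (Y : Sm k) : mor Y (affine_space_Sm m Y) :=
  @Mor k Y (affine_space_Sm m Y) (fun A y => (0, y)) (@zero_section_nat m Y).

Definition projection m (Y : Sm k) : mor (affine_space_Sm m Y) Y :=
  @Mor k (affine_space_Sm m Y) Y (fun A p => p.2) (fun _ _ _ _ => erefl).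

Let U := @open_Sm k B (nonvanishing M) (@nonvanishing_open M).
Let j : mor U B := incl (nonvanishing M).

(** Where x has an inverse u, multiplication of v by u undoes the scaling. *)
Lemma scaling_image A (p : B A) :
  nonvanishing M A p <-> mor_image (mor_comp scaling j) A p.
Proof.
split=> [[u pu]|[[q qU] <-]]; last exact: qU.
case: p pu => x [v z] xu.
have qU : nonvanishing M A (x, (u *: v, z)) by exists u.
by exists (exist _ _ qU); rewrite /= scalerA xu scale1r.
Qed.

Lemma scaling_open_immersion : open_immersion (mor_comp scaling j).
Proof.
split; last by apply: open_sub_ext scaling_image _; exact: nonvanishing_open.
move=> A [[x [v z]] [u xu]] [[x' [v' z']] [u' xu']] /= [xx' vv' zz'].
apply: (@sub_eq k _ (nonvanishing M)) => /=; rewrite -xx' -zz'; congr (_, (_, _)).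
move: vv' => /(congr1 (fun w => u *: w)); rewrite -xx' !scalerA mulrC.
by rewrite xu !scale1r.
Qed.

End Scaling.

Section Birational.
Variables (C : coefficients) (S : presheaf k C).
Hypothesis S1 : birational_B1 S.

Lemma open_restriction_bij (X : Sm k) (U : subfunctor X) (UO : open_sub U) :
  dense_sub U -> bijective (app (@pullback k C S (open_Sm UO) X (incl U))).
Proof.
move=> UD; apply: S1; first exact: open_immersion_incl.
exact: dense_sub_incl.
Qed.

(* Both the inclusion j of the locus x <> 0 and scaling o j are dense open
   immersions, so (B1) gives the bijectivity of scaling. *)
Lemma scaling_bij n (Z : Sm k) :
  bijective (app (pullback S (scaling n Z))).
Proof.
pose M := affine_space_Sm n Z.
have jb := @open_restriction_bij (affine_space_Sm 1 M) (nonvanishing M)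
  (@nonvanishing_open M) (@nonvanishing_dense M).
set j := pullback S _ in jb.
have [|h hK Kh] := S1 (scaling_open_immersion n Z).
  by apply: dense_sub_ext (@scaling_image n Z) _; exact: nonvanishing_dense.
have [g gK _] := jb.
exists (h \o app j) => x /=; first by rewrite -pullback_comp hK.
by apply: (can_inj gK); rewrite -pullback_comp Kh.
Qed.

(** The composite of the zero section with the projection is not the identity of A^n x Z; it acts as
    the identity on sections because each of them is pulled back from Z. *)
Lemma affine_space_invariance n (Z : Sm k) s :
  app (pullback S (projection n Z)) (app (pullback S (zero_section n Z)) s) = s.
Proof.
pose M := affine_space_Sm n Z; pose B := affine_space_Sm 1 M.
pose p := projection n Z; pose o := zero_section n Z.
pose e := zero_section 1 M.
have [f _ Kf] := scaling_bij n Z.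
pose s' := f (app (pullback S (projection 1 M)) s).
(* e is the section x = 0 of the projection to M, and scaling o e = e o o o p, since both send (v,
   z) to (0, 0, z). *)
have sE : s = app (pullback S p) (app (pullback S o) (app (pullback S e) s')).
  rewrite -!pullback_comp -[LHS](@pullback_id k C S M).
  have -> : mor_id M = mor_comp (projection 1 M) e by exact: mor_ext.
  rewrite pullback_comp -[app _ s]Kf -pullback_comp.
  congr (app (pullback S _) _); apply: mor_ext => A [v z] /=.
  by rewrite mxE scale0r.
have op t : app (pullback S o) (app (pullback S p) t) = t.
  rewrite -pullback_comp -[RHS]pullback_id.
  by congr (app (pullback S _) _); exact: mor_ext.
by rewrite [in LHS]sE op -sE.
Qed.

End Birational.
End Invariance.

(** * Composites and inverses in the three categories of coefficients *)

Lemma hom_comp_exists (C : coefficients) (a b c : obj C)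
    (g : Defs.hom b c) (f : Defs.hom a b) :
  exists h : Defs.hom a c, forall x, app h x = app g (app f x).
Proof.
case: C a b c g f => /= a b c g f; first by exists (g \o f).
- by exists (g \o f : {multiplicative a -> c}).
- by exists (g \o f : {additive a -> c}).
Qed.

(** (B1) gives bijections of underlying sets, while a direct summand needs morphisms: the inverse of
    a bijective homomorphism is again one. *)
Lemma hom_inverse (C : coefficients) (a b : obj C) (f : Defs.hom a b) :
  bijective (app f) -> exists g : Defs.hom b a,
    cancel (app f) (app g) /\ cancel (app g) (app f).
Proof.
case: C a b f => /= a b f [g fK gK]; first by exists g.
- have gM : {morph g : x y / (x * y)%g}.
    by move=> x y; apply: (can_inj fK); rewrite gmulfM !gK.
  pose m := isMultiplicative.Build b a g gM.
  by exists (HB.pack g m : {multiplicative b -> a}).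
- have gB : {morph g : x y / x - y} by exact: can2_zmod_morphism fK gK.
  pose m := GRing.isZmodMorphism.Build b a g gB.
  by exists (HB.pack g m : {additive b -> a}).
Qed.

Theorem theorem1p11 (k : fieldType) (hk : perfect_field k)
  (C : coefficients) (S : presheaf k C) (hS : birational S)
  (X : Sm k) (i : nat) (hX : retract_rational i X) :
  exists Z : Sm k, krull_dim Z i /\ direct_summand (S X) (S Z).
Proof.
case: hS => _ S1; case: hX => _ [n [_ _ [N [Z [_ _ dimZ _ [f [g [W [WO WD fgW]]]]]]]]].
exists Z; split=> //.
pose Y := affine_space_Sm (N - i) Z.
pose V := @open_Sm k Y (rat_dom g) (rat_open g); pose W' := open_Sm WO.
have gfW A (x : sub_to_functor W A) : exists u : rat_dom f A (sval x),
    rat_dom g A (f A (exist _ (sval x) u)).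
  by have [u [v _]] := fgW A _ (svalP x); exists u.
(* f restricted to W, with values in dom g. The membership proofs come from choice; naturality
   survives because points of a subfunctor are equal as soon as their underlying points are. *)
pose phi_fun A (x : W' A) : V A :=
  exist _ (f A (exist _ (sval x) (projT1 (cid (gfW A x)))))
    (projT2 (cid (gfW A x))).
have phi_nat A B (h : khom A B) x : phi_fun B (fmap W' h x) = fmap V h (phi_fun A x).
  apply: (@sub_eq k Y (rat_dom g)); apply: etrans (mor_nat f h _) => /=.
  by congr (f B _); exact: sub_eq.
pose phi : mor W' V := Mor phi_nat.
pose gV : mor V X := rat_mor g.
have gphi : mor_comp gV phi = incl W :> mor W' X.
  apply: mor_ext => A x; have [u [v gE]] := fgW A _ (svalP x).
  rewrite /= -[RHS]gE; congr (g A _); apply: (@sub_eq k Y (rat_dom g)) => /=.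
  by congr (f A _); exact: sub_eq.
have [rV [_ jrV]] := hom_inverse (open_restriction_bij S1
  (rat_open g : @open_sub k Y _) (@rat_dense _ _ _ g)).
have [rW [jrW _]] := hom_inverse (open_restriction_bij S1 WO WD).
(* s is S(X) -> S(dom g) = S(Y) -> S(Z), along g and the zero section; r is S(Z) -> S(Y) -> S(dom g)
   -> S(W) = S(X), along the projection, the inclusion and [phi]. *)
have [s1 s1E] := hom_comp_exists rV (pullback S gV).
have [s sE] := hom_comp_exists (pullback S (zero_section (N - i) Z)) s1.
have [r1 r1E] := hom_comp_exists (@pullback k C S V Y (incl (rat_dom g)))
  (pullback S (projection (N - i) Z)).
have [r2 r2E] := hom_comp_exists (pullback S phi) r1.
have [r rE] := hom_comp_exists rW r2.
exists s, r => x; rewrite rE r2E r1E sE s1E affine_space_invariance // jrV.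
by rewrite -pullback_comp gphi jrW.
Qed.
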